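(* The groupoids of Deaconu-Renault systems $(X,T)$ with $X$ compact Hausdorff and totally disconnected and $\operatorname{dom}(T)$ clopen are precisely the groupoids of semi-saturated orthogonal partial actions of finitely generated free groups on compact Hausdorff and totally disconnected spaces with clopen domains. That is, a topological groupoid is isomorphic (as a topological groupoid) to $\mathcal G_{(X,T)}$ for some such Deaconu-Renault system $(X,T)$ if and only if it is isomorphic to $F_A\ltimes Y$ for some finite set $A$ and some semi-saturated orthogonal partial action of the free group $F_A$, with clopen domains, on a compact Hausdorff totally disconnected space $Y$.
   Context: Partial actions: a partial action $\theta$ (with clopen domains) of a group $G$ on a locally compact Hausdorff totally disconnected space $X$ consists of, for each $g\in G$, a clopen subset $X_g\subseteq X$ and a homeomorphism $\theta_g\colon X_{g^{-1}}\to X_g$ such that $X_1=X$, $\theta_1=\mathrm{id}_X$, $\theta_g^{-1}=\theta_{g^{-1}}$, and whenever $\theta_g(\theta_h(x))$ is defined, $\theta_{gh}(x)$ is defined and equals it. $F_A$ is the free group on the set $A$ and $|w|$ is the length of the reduced word for $w\in F_A$. A partial action of $F_A$ is semi-saturated if $\theta_{uv}=\theta_u\circ\theta_v$ (equality of partial maps, including domains) whenever $|uv|=|u|+|v|$; it is orthogonal if $X_a\cap X_b=\emptyset$ for all $a\ne b$ in $A$. Groupoid of a partial action: $G\ltimes X$ has object space $X$ and arrow space $\{(g,x)\mid x\in X_{g^{-1}}\}\subseteq G\times X$ (subspace topology of the product topology, $G$ discrete), with $s(g,x)=x$, $r(g,x)=\theta_g(x)$, $(g,\theta_h(x))(h,x)=(gh,x)$,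 $(g,x)^{-1}=(g^{-1},\theta_g(x))$. Deaconu-Renault: a Deaconu-Renault system $(X,T)$ consists of a locally compact Hausdorff space $X$ and a local homeomorphism $T\colon\operatorname{dom}(T)\to X$ where $\operatorname{dom}(T)$ is an open subset of $X$. $T^n$ denotes the $n$-fold composition of the partial map $T$, with its natural domain. The groupoid $\mathcal G_{(X,T)}$ has object space $X$ and arrows $\{(x,m-n,y)\in\operatorname{dom}(T^m)\times\mathbb Z\times\operatorname{dom}(T^n)\mid m,n\ge 0,\ T^m(x)=T^n(y)\}$ with $s(x,k,y)=y$, $r(x,k,y)=x$, product $(x,k,y)(y,l,z)=(x,k+l,z)$ and inverse $(x,k,y)^{-1}=(y,-k,x)$. Its topology has as basis the sets $\{(x,m-n,y)\in V\times\mathbb Z\times W\mid T^m(x)=T^n(y)\}$ with $V\subseteq\operatorname{dom}(T^m)$, $W\subseteq\operatorname{dom}(T^n)$ open, $T^m|_V$, $T^n|_W$ injective and $T^m(V)=T^n(W)$. *)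

(* Defs.v *)
From HB Require Import structures.
From mathcomp Require Import all_boot all_order all_algebra.
From mathcomp Require Import all_classical topology.

Set Implicit Arguments.
Unset Strict Implicit.
Unset Printing Implicit Defensive.

Import Order.TTheory GRing.Theory.

Local Open Scope classical_set_scope.

(* [f] restricts to a homeomorphism from the subspace [A] onto the subspace
   [B], with inverse the restriction of [g]; the values of [f] outside [A]
   and of [g] outside [B] are irrelevant. *)
Definition homeo_between (X Y : topologicalType) (A : set X) (B : set Y)
    (f : X -> Y) (g : Y -> X) : Prop :=
  [/\ set_fun A B f,
      set_fun B A g,
      (forall x, A x -> g (f x) = x) /\ (forall y, B y -> f (g y) = y),
      {within A, continuous f} &
      {within B, continuous g}].

Record topGroupoid := TopGroupoid {
  gobj : topologicalType;
  garr : topologicalType;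
  gsrc : garr -> gobj;
  grng : garr -> gobj;
  gidn : gobj -> garr;
  gmul : forall g h : garr, gsrc g = grng h -> garr;
  ginv : garr -> garr;
  gsrc_idn : forall x, gsrc (gidn x) = x;
  grng_idn : forall x, grng (gidn x) = x;
  gsrc_mul : forall g h (e : gsrc g = grng h), gsrc (gmul e) = gsrc h;
  grng_mul : forall g h (e : gsrc g = grng h), grng (gmul e) = grng g;
  gsrc_inv : forall g, gsrc (ginv g) = grng g;
  grng_inv : forall g, grng (ginv g) = gsrc g;
  gmul_idl : forall x g (e : gsrc (gidn x) = grng g), gmul e = g;
  gmul_idr : forall g x (e : gsrc g = grng (gidn x)), gmul e = g;
  gmul_invl : forall g (e : gsrc (ginv g) = grng g), gmul e = gidn (gsrc g);
  gmul_invr : forall g (e : gsrc g = grng (ginv g)), gmul e = gidn (grng g);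
  gmul_assoc : forall g h k (gh : gsrc g = grng h) (hk : gsrc h = grng k)
    (gh_k : gsrc (gmul gh) = grng k) (g_hk : gsrc g = grng (gmul hk)),
    gmul gh_k = gmul g_hk;
  gsrc_continuous : continuous gsrc;
  grng_continuous : continuous grng;
  gidn_continuous : continuous gidn;
  ginv_continuous : continuous ginv;
  gmul_continuous :
    continuous (fun p : [set p : garr * garr | gsrc p.1 = grng p.2] =>
      gmul (set_valP p))
}.

(* Compatibility with inverses follows from these conditions. *)
Definition groupoid_iso (G H : topGroupoid) : Prop :=
  exists (f0 : gobj G -> gobj H) (g0 : gobj H -> gobj G)
         (f1 : garr G -> garr H) (g1 : garr H -> garr G),
    [/\ homeo_between setT setT f0 g0,
        homeo_between setT setT f1 g1,
        (forall g, gsrc (f1 g) = f0 (gsrc g)) /\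
        (forall g, grng (f1 g) = f0 (grng g)),
        (forall x, f1 (gidn x) = gidn (f0 x)) &
        (forall (g h : garr G) (e : gsrc g = grng h)
           (e' : gsrc (f1 g) = grng (f1 h)), f1 (gmul e) = gmul e')].

Section FreeGroup.
Variable A : choiceType.

(* [(a, true)] is the generator [a], [(a, false)] its formal inverse. *)
Definition letter : Type := (A * bool)%type.
HB.instance Definition _ := Choice.on letter.

Definition letter_inv (x : letter) : letter := (x.1, ~~ x.2).

Definition reduced (w : seq letter) : bool :=
  sorted (fun x y => y != letter_inv x) w.

Record free_group := FreeGroup {
  reduced_word :> seq letter;
  reduced_wordP : reduced reduced_word
}.
HB.instance Definition _ := [isSub for reduced_word].
HB.instance Definition _ := [Choice of free_group by <:].

Implicit Types (x y : letter) (u v w : seq letter) (g h : free_group).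

Lemma letter_invK : involutive letter_inv.
Proof. by case=> a b; rewrite /letter_inv /= negbK. Qed.

Definition cons_red x w : seq letter :=
  if w is y :: w' then if y == letter_inv x then w' else x :: w else [:: x].

Definition mul_red u v : seq letter := foldr cons_red v u.

Definition inv_red u : seq letter := rev (map letter_inv u).

Lemma reduced_behead x w : reduced (x :: w) -> reduced w.
Proof. exact: path_sorted. Qed.

Lemma cons_red_reduced x w : reduced w -> reduced (cons_red x w).
Proof.
case: w => //= y w; case: eqVneq => [_|yx] /= rw; last by rewrite /= yx.
exact: (@reduced_behead y).
Qed.

Lemma mul_red_reduced u v : reduced v -> reduced (mul_red u v).
Proof. by move=> rv; elim: u => //= x u; apply: cons_red_reduced. Qed.

Lemma inv_red_reduced u : reduced u -> reduced (inv_red u).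
Proof.
rewrite /reduced /inv_red rev_sorted sorted_map; apply: sub_sorted => x y /=.
by rewrite /relpre /= letter_invK eq_sym.
Qed.

Lemma cons_red_cons x w : reduced (x :: w) -> cons_red x w = x :: w.
Proof. by case: w => //= y w /andP[/negPf ->]. Qed.

Lemma cons_redK x w : reduced w -> cons_red (letter_inv x) (cons_red x w) = w.
Proof.
case: w => [|y w]; first by rewrite /= letter_invK eqxx.
rewrite /=; case: eqVneq => [-> rw|yx rw]; last by rewrite /= letter_invK eqxx.
exact: cons_red_cons.
Qed.

Lemma mul_redr0 u : reduced u -> mul_red u [::] = u.
Proof.
elim: u => //= x u IH rxu.
by rewrite IH ?cons_red_cons //; apply: reduced_behead rxu.
Qed.

Lemma mul_red_cons x v w : reduced v -> reduced w ->
  mul_red (cons_red x v) w = cons_red x (mul_red v w).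
Proof.
case: v => //= y v rv rw; case: eqVneq => // ->.
by rewrite -{1}[x]letter_invK cons_redK //; apply: mul_red_reduced.
Qed.

Lemma mul_redA u v w : reduced v -> reduced w ->
  mul_red u (mul_red v w) = mul_red (mul_red u v) w.
Proof.
move=> rv rw; elim: u => //= x u ->.
by rewrite mul_red_cons //; apply: mul_red_reduced.
Qed.

Lemma mul_redVr u : reduced u -> mul_red (inv_red u) u = [::].
Proof.
rewrite /inv_red; elim: u => //= x u IH rxu.
rewrite rev_cons /mul_red foldr_rcons [cons_red _ _]/= letter_invK eqxx.
by apply: IH; apply: reduced_behead rxu.
Qed.

Lemma inv_redK : involutive inv_red.
Proof.
by move=> u; rewrite /inv_red map_rev revK -map_comp map_id_in // => x _;
  apply: letter_invK.
Qed.

Definition fg_one : free_group := @FreeGroup [::] isT.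
Definition fg_inv g : free_group :=
  FreeGroup (inv_red_reduced (reduced_wordP g)).
Definition fg_mul g h : free_group :=
  FreeGroup (mul_red_reduced g (reduced_wordP h)).

Lemma fg_mulA : associative fg_mul.
Proof.
by move=> g h k; apply: val_inj; apply: mul_redA; apply: reduced_wordP.
Qed.

Lemma fg_mul1g : left_id fg_one fg_mul.
Proof. by move=> g; apply: val_inj. Qed.

Lemma fg_mulg1 : right_id fg_one fg_mul.
Proof. by move=> g; apply: val_inj; apply: mul_redr0; apply: reduced_wordP. Qed.

Lemma fg_mulVg : left_inverse fg_one fg_inv fg_mul.
Proof. by move=> g; apply: val_inj; apply: mul_redVr; apply: reduced_wordP. Qed.

Lemma fg_mulgV : right_inverse fg_one fg_inv fg_mul.
Proof.
move=> g; apply: val_inj => /=; rewrite -{1}[reduced_word g]inv_redK.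
by apply: mul_redVr; apply: inv_red_reduced; apply: reduced_wordP.
Qed.

HB.instance Definition _ :=
  isGroup.Build free_group fg_mulA fg_mul1g fg_mulg1 fg_mulVg fg_mulgV.

Definition fg_gen (a : A) : free_group := @FreeGroup [:: (a, true)] isT.

Definition fg_length g : nat := size (reduced_word g).

End FreeGroup.

(* [pa_dom theta g] is X_g.  [pa_act theta g] stands for theta_g and is only
   meaningful on X_{g^-1}. *)
Record partialAction (G : groupType) (X : topologicalType) := PartialAction {
  pa_dom : G -> set X;
  pa_act : G -> X -> X;
  pa_locally_compact : locally_compact [set: X];
  pa_hausdorff : hausdorff_space X;
  pa_totally_disconnected : totally_disconnected [set: X];
  pa_clopen : forall g, clopen (pa_dom g);
  pa_homeo : forall g,
    homeo_between (pa_dom g^-1%g) (pa_dom g) (pa_act g) (pa_act g^-1%g);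
  pa_dom1 : pa_dom 1%g = setT;
  pa_act1 : forall x, pa_act 1%g x = x;
  pa_actM : forall g h x, pa_dom h^-1%g x -> pa_dom g^-1%g (pa_act h x) ->
    pa_dom (g * h)^-1%g x /\ pa_act (g * h)%g x = pa_act g (pa_act h x)
}.

Section PartialActionGroupoid.
Variables (G : groupType) (X : topologicalType) (theta : partialAction G X).
Local Notation D := (pa_dom theta).
Local Notation act := (pa_act theta).

Definition pa_arr : set (discrete_topology G * X) :=
  [set p | D (p.1 : G)^-1%g p.2].

Implicit Types p q : pa_arr.

Definition pa_elt p : G := (val p).1.
Definition pa_src p : X := (val p).2.
Definition pa_rng p : X := act (pa_elt p) (pa_src p).

Definition pa_mk (g : G) (x : X) (gx : D g^-1%g x) : pa_arr :=
  SigSub (mem_set (gx : pa_arr (g, x))).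

Lemma pa_arrP p : D (pa_elt p)^-1%g (pa_src p).
Proof. exact: (set_valP p). Qed.

Lemma pa_arr_eq p q : pa_elt p = pa_elt q -> pa_src p = pa_src q -> p = q.
Proof.
rewrite /pa_elt /pa_src => e1 e2; apply: val_inj.
by case: (val p) (val q) e1 e2 => [? ?] [? ?] /= -> ->.
Qed.

Lemma pa_idn_subproof x : D 1^-1%g x.
Proof. by rewrite invg1 pa_dom1. Qed.

Lemma pa_inv_subproof p : D (pa_elt p)^-1^-1%g (pa_rng p).
Proof.
have [act_fun _ _ _ _] := pa_homeo theta (pa_elt p).
by rewrite invgK; exact: (act_fun _ (pa_arrP p)).
Qed.

Lemma pa_mul_subproof p q : pa_src p = pa_rng q ->
  D (pa_elt p * pa_elt q)^-1%g (pa_src q).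
Proof.
move=> e; have := pa_arrP p; rewrite e => Dp.
by have [] := pa_actM (pa_arrP q) Dp.
Qed.

Definition pa_idn x : pa_arr := pa_mk (pa_idn_subproof x).
Definition pa_inv p : pa_arr := pa_mk (pa_inv_subproof p).
Definition pa_mul p q (e : pa_src p = pa_rng q) : pa_arr :=
  pa_mk (pa_mul_subproof e).

Lemma pa_elt_idn x : pa_elt (pa_idn x) = 1%g. Proof. by []. Qed.
Lemma pa_elt_inv p : pa_elt (pa_inv p) = (pa_elt p)^-1%g. Proof. by []. Qed.
Lemma pa_elt_mul p q (e : pa_src p = pa_rng q) :
  pa_elt (pa_mul e) = (pa_elt p * pa_elt q)%g.
Proof. by []. Qed.

Lemma pa_rng_idn x : pa_rng (pa_idn x) = x.
Proof. exact: pa_act1. Qed.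

Lemma pa_rng_mul p q (e : pa_src p = pa_rng q) : pa_rng (pa_mul e) = pa_rng p.
Proof.
have := pa_arrP p; rewrite e => Dp.
by have [_] := pa_actM (pa_arrP q) Dp; rewrite /pa_rng /= e.
Qed.

Lemma pa_rng_inv p : pa_rng (pa_inv p) = pa_src p.
Proof.
have [_ _ [actK _] _ _] := pa_homeo theta (pa_elt p).
exact: actK (pa_arrP p).
Qed.

Lemma pa_mul_idl x p (e : pa_src (pa_idn x) = pa_rng p) : pa_mul e = p.
Proof. by apply: pa_arr_eq => //; rewrite pa_elt_mul mul1g. Qed.

Lemma pa_mul_idr p x (e : pa_src p = pa_rng (pa_idn x)) : pa_mul e = p.
Proof.
apply: pa_arr_eq; first by rewrite pa_elt_mul mulg1.
by rewrite e pa_rng_idn.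
Qed.

Lemma pa_mul_invl p (e : pa_src (pa_inv p) = pa_rng p) :
  pa_mul e = pa_idn (pa_src p).
Proof. by apply: pa_arr_eq => //; rewrite pa_elt_mul mulVg. Qed.

Lemma pa_mul_invr p (e : pa_src p = pa_rng (pa_inv p)) :
  pa_mul e = pa_idn (pa_rng p).
Proof. by apply: pa_arr_eq => //; rewrite pa_elt_mul mulgV. Qed.

Lemma pa_mul_assoc p q r (pq : pa_src p = pa_rng q) (qr : pa_src q = pa_rng r)
  (pq_r : pa_src (pa_mul pq) = pa_rng r)
  (p_qr : pa_src p = pa_rng (pa_mul qr)) : pa_mul pq_r = pa_mul p_qr.
Proof. by apply: pa_arr_eq => //; rewrite !pa_elt_mul mulgA. Qed.

Lemma pa_elt_near p : \forall q \near p, pa_elt q = pa_elt p.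
Proof.
have : nbhs (val p) [set q : discrete_topology G * X | q.1 = pa_elt p].
  exists ([set pa_elt p], setT); last by case=> ? ? [].
  by split; [apply: discrete_set1|apply: filterT].
exact: initial_continuous.
Qed.

Lemma pa_src_continuous : continuous pa_src.
Proof.
move=> p; apply: continuous_comp; first exact: initial_continuous.
exact: cvg_snd.
Qed.

Lemma pa_act_continuous g x : D g^-1%g x -> {for x, continuous (act g)}.
Proof.
move=> Dx; case: (pa_homeo theta g) => _ _ _ + _.
have [oD _] := pa_clopen theta g^-1%g.
by rewrite continuous_open_subspace // => /(_ x); apply; rewrite inE.
Qed.

Lemma pa_rng_continuous : continuous pa_rng.
Proof.
move=> p U /(pa_act_continuous (pa_arrP p)) /(pa_src_continuous (x := p)) nU.
rewrite nbhs_simpl /=; near=> q; change (U (act (pa_elt q) (pa_src q))).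
have -> : pa_elt q = pa_elt p by near: q; apply: pa_elt_near.
by near: q.
Unshelve. all: by end_near.
Qed.

Lemma pa_continuous (Y : topologicalType) (f : Y -> pa_arr) :
  (forall y, \forall z \near y, pa_elt (f z) = pa_elt (f y)) ->
  continuous (pa_src \o f) -> continuous f.
Proof.
move=> elt_f src_f; apply: continuous_comp_initial => y.
move=> U [[V W] /= [nV nW] VWU]; rewrite nbhs_simpl /=; near=> z.
rewrite /=; apply: VWU; split => /=; last by near: z; apply: src_f.
have -> : (val (f z)).1 = (val (f y)).1 by near: z; apply: elt_f.
exact: nbhs_singleton.
Unshelve. all: by end_near.
Qed.

Lemma pa_idn_continuous : continuous pa_idn.
Proof.
apply: pa_continuous => [x|x]; first exact: nearW.
exact: cvg_id.
Qed.

Lemma pa_inv_continuous : continuous pa_inv.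
Proof.
apply: pa_continuous => [p|]; last exact: pa_rng_continuous.
by apply: filterS (pa_elt_near p) => q e; rewrite !pa_elt_inv e.
Qed.

Lemma pa_mul_continuous :
  continuous (fun p : [set p : pa_arr * pa_arr | pa_src p.1 = pa_rng p.2] =>
    pa_mul (set_valP p)).
Proof.
pose C := [set p : pa_arr * pa_arr | pa_src p.1 = pa_rng p.2].
have c1 : continuous (fun p : C => (val p).1).
  move=> p; apply: continuous_comp; first exact: initial_continuous.
  exact: cvg_fst.
have c2 : continuous (fun p : C => (val p).2).
  move=> p; apply: continuous_comp; first exact: initial_continuous.
  exact: cvg_snd.
apply: pa_continuous => [p|p]; last first.
  change (continuous_at p (pa_src \o (fun p : C => (val p).2))).
  by apply: continuous_comp; [apply: c2|apply: pa_src_continuous].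
have n1 : nbhs p [set q : C | pa_elt (val q).1 = pa_elt (val p).1].
  exact: (c1 p _ (pa_elt_near (val p).1)).
have n2 : nbhs p [set q : C | pa_elt (val q).2 = pa_elt (val p).2].
  exact: (c2 p _ (pa_elt_near (val p).2)).
apply: filterS2 n1 n2 => q e1 e2.
by rewrite !pa_elt_mul; congr (_ * _)%g; [apply: e1|apply: e2].
Qed.

Definition pa_groupoid : topGroupoid := {|
  gobj := X;
  garr := pa_arr : topologicalType;
  gsrc := pa_src;
  grng := pa_rng;
  gidn := pa_idn;
  gmul := pa_mul;
  ginv := pa_inv;
  gsrc_idn := fun=> erefl;
  grng_idn := pa_rng_idn;
  gsrc_mul := fun _ _ _ => erefl;
  grng_mul := pa_rng_mul;
  gsrc_inv := fun=> erefl;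
  grng_inv := pa_rng_inv;
  gmul_idl := pa_mul_idl;
  gmul_idr := pa_mul_idr;
  gmul_invl := pa_mul_invl;
  gmul_invr := pa_mul_invr;
  gmul_assoc := pa_mul_assoc;
  gsrc_continuous := pa_src_continuous;
  grng_continuous := pa_rng_continuous;
  gidn_continuous := pa_idn_continuous;
  ginv_continuous := pa_inv_continuous;
  gmul_continuous := pa_mul_continuous
|}.

End PartialActionGroupoid.

Section FreePartialAction.
Variables (A : choiceType) (X : topologicalType).
Variable theta : partialAction (free_group A) X.
Local Notation D := (pa_dom theta).
Local Notation act := (pa_act theta).

Definition pa_semi_saturated : Prop :=
  forall u v : free_group A,
    fg_length (u * v)%g = (fg_length u + fg_length v)%N ->
    D (u * v)^-1%g = [set x | D v^-1%g x /\ D u^-1%g (act v x)] /\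
    (forall x, D (u * v)^-1%g x -> act (u * v)%g x = act u (act v x)).

Definition pa_orthogonal : Prop :=
  forall a b : A, a != b -> D (fg_gen a) `&` D (fg_gen b) = set0.

End FreePartialAction.

Definition local_homeo_on (X Y : topologicalType) (dom : set X) (T : X -> Y) :=
  forall x, dom x -> exists (U : set X) (S : Y -> X),
    [/\ open U, U x, U `<=` dom, open (T @` U) &
        homeo_between U (T @` U) T S].

(* [dr_map] stands for the partial map T and is only meaningful on [dr_dom]. *)
Record deaconuRenault (X : topologicalType) := DeaconuRenault {
  dr_dom : set X;
  dr_map : X -> X;
  dr_locally_compact : locally_compact [set: X];
  dr_hausdorff : hausdorff_space X;
  dr_dom_open : open dr_dom;
  dr_local_homeo : local_homeo_on dr_dom dr_map
}.

Section DeaconuRenaultGroupoid.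
Variables (X : topologicalType) (S : deaconuRenault X).
Local Notation T := (dr_map S).

(* The natural domain of the [n]-fold composition of the partial map T, on
   which that composition is [iter n T]. *)
Definition dr_idom (n : nat) : set X :=
  [set x | forall i, (i < n)%N -> dr_dom S (iter i T x)].

Definition dr_rel (m n : nat) (x : X) (k : int) (y : X) : Prop :=
  [/\ dr_idom m x, dr_idom n y, k = (m%:Z - n%:Z)%R &
      iter m T x = iter n T y].

Record dr_arr := DRArr {
  dr_rng : X;
  dr_lag : int;
  dr_src : X;
  dr_arrP : exists m n, dr_rel m n dr_rng dr_lag dr_src
}.
HB.instance Definition _ := gen_eqMixin dr_arr.
HB.instance Definition _ := gen_choiceMixin dr_arr.

Implicit Types (g h : dr_arr) (V W : set X).

Lemma dr_arr_eq g h : dr_rng g = dr_rng h -> dr_lag g = dr_lag h ->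
  dr_src g = dr_src h -> g = h.
Proof.
case: g h => [x k y P] [x' k' y' P'] /= ex ek ey; subst.
by rewrite (Prop_irrelevance P P').
Qed.

(* The indices ((m, V), (n, W)) of the basic open sets [dr_base]. *)
Definition dr_base_index : set ((nat * set X) * (nat * set X)) :=
  [set i | let: ((m, V), (n, W)) := i in
    [/\ open V /\ V `<=` dr_idom m,
        open W /\ W `<=` dr_idom n,
        set_inj V (iter m T), set_inj W (iter n T) &
        iter m T @` V = iter n T @` W]].

Definition dr_base (i : (nat * set X) * (nat * set X)) : set dr_arr :=
  let: ((m, V), (n, W)) := i in
  [set g | [/\ V (dr_rng g), W (dr_src g), dr_lag g = (m%:Z - n%:Z)%R &
               iter m T (dr_rng g) = iter n T (dr_src g)]].

Lemma dr_idomD m n x :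
  dr_idom (m + n) x <-> dr_idom m x /\ dr_idom n (iter m T x).
Proof.
split=> [Dx|[Dm Dn] i imn].
  split=> i ilt; first by apply: Dx; apply: ltn_addr.
  by rewrite -iterD; apply: Dx; rewrite addnC ltn_add2l.
have [im|mi] := ltnP i m; first exact: Dm.
by rewrite -(subnK mi) iterD; apply: Dn; rewrite ltn_subLR.
Qed.

Lemma dr_idomS n x : dr_idom n.+1 x <-> dr_idom n x /\ dr_dom S (iter n T x).
Proof.
rewrite -addn1; split=> [/dr_idomD[Dn /(_ 0%N)]|[Dn Dx]]; first by split; auto.
by apply/dr_idomD; split=> // -[].
Qed.

Lemma dr_map_continuous x : dr_dom S x -> {for x, continuous T}.
Proof.
move=> /(dr_local_homeo)[U [R [oU Ux _ _ [_ _ _ + _]]]].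
by rewrite continuous_open_subspace // => /(_ x); apply; rewrite inE.
Qed.

Lemma dr_map_open V : open V -> V `<=` dr_dom S -> open (T @` V).
Proof.
move=> oV VD; rewrite openE => _ [x Vx <-].
have [U [R [oU Ux _ oTU [_ RU [RT TR] _]]]] := dr_local_homeo (VD _ Vx).
rewrite continuous_open_subspace // => cR.
have TUx : (T @` U) (T x) by exists x.
have nV : nbhs (R (T x)) (V `&` U).
  by rewrite RT //; apply: open_nbhs_nbhs; split=> //; apply: openI.
have cRx := cR (T x); rewrite inE in cRx.
have nU : nbhs (T x) (T @` U) by apply: open_nbhs_nbhs; split.
rewrite /interior; apply: filterS2 nU (cRx TUx _ nV).
by move=> y TUy [VRy _]; exists (R y) => //; apply: TR.
Qed.

Lemma dr_map_inj x : dr_dom S x -> exists U : set X, nbhs x U /\ set_inj U T.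
Proof.
move=> /(dr_local_homeo)[U [R [oU Ux _ _ [_ _ [RT _] _ _]]]].
exists U; split; first by apply: open_nbhs_nbhs; split.
by move=> y z /set_mem Uy /set_mem Uz e; rewrite -(RT _ Uy) e RT.
Qed.

Lemma dr_iter_continuous n x : dr_idom n x -> {for x, continuous (iter n T)}.
Proof.
elim: n => [|n IH]; first by move=> _; apply: cvg_id.
move=> /dr_idomS[Dn Dx]; apply: (@continuous_comp _ _ _ (iter n T) T).
  exact: IH.
exact: dr_map_continuous.
Qed.

Lemma dr_idom_near n x : dr_idom n x -> nbhs x (dr_idom n).
Proof.
elim: n x => [|n IH] x; first by move=> _; apply: filterS filterT => y _ [].
move=> /dr_idomS[Dn Dx]; near=> y; apply/dr_idomS; split; near: y.
  exact: IH.
apply: dr_iter_continuous => //.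
by apply: open_nbhs_nbhs; split=> //; apply: dr_dom_open.
Unshelve. all: by end_near.
Qed.

Lemma dr_iter_open n V : open V -> V `<=` dr_idom n -> open (iter n T @` V).
Proof.
move=> oV; elim: n => [|n IH] VD; first by rewrite image_id.
have -> : iter n.+1 T @` V = T @` (iter n T @` V) by rewrite -image_comp.
apply: dr_map_open; first by apply: IH => x /VD /dr_idomS[].
by move=> _ [x /VD /dr_idomS[_ Dx] <-].
Qed.

Lemma dr_iter_inj n x : dr_idom n x ->
  exists U : set X, nbhs x U /\ set_inj U (iter n T).
Proof.
elim: n => [|n IH]; first by exists setT; split=> //; apply: filterT.
move=> /dr_idomS[Dn /dr_map_inj[U' [nU' iU']]]; have [U [nU iU]] := IH Dn.
exists (U `&` iter n T @^-1` U'); split.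
  by apply: filterI => //; apply: dr_iter_continuous nU'.
move=> y z /set_mem[Uy U'y] /set_mem[Uz U'z] /= e.
by apply: iU; rewrite ?inE //; apply: iU'; rewrite ?inE.
Qed.

Lemma dr_base_local m n x k y (V W : set X) : dr_rel m n x k y ->
  nbhs x V -> nbhs y W ->
  exists V' W' : set X, [/\ dr_base_index ((m, V'), (n, W')),
    V' x, W' y, V' `<=` V & W' `<=` W].
Proof.
move=> [Dx Dy _ e] nV nW.
have loc p z (U : set X) : dr_idom p z -> nbhs z U -> exists U' : set X,
    [/\ open U', U' z, U' `<=` U, U' `<=` dr_idom p & set_inj U' (iter p T)].
  move=> Dz nU; have [O [nO iO]] := dr_iter_inj Dz.
  have : nbhs z (U `&` (dr_idom p `&` O)).
    by apply: filterI => //; apply: filterI => //; apply: dr_idom_near.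
  rewrite nbhsE => -[U' [oU' U'z] sU'].
  exists U'; split=> // [t /sU'[]//|t /sU'[_ []]//|].
  move=> s t /set_mem /sU'[_ [_ Os]] /set_mem /sU'[_ [_ Ot]].
  by apply: iO; rewrite inE.
have [V1 [oV1 V1x sV1 DV1 iV1]] := loc _ _ _ Dx nV.
have [W1 [oW1 W1y sW1 DW1 iW1]] := loc _ _ _ Dy nW.
pose O := (iter m T @` V1) `&` (iter n T @` W1).
have oO : open O by apply: openI; apply: dr_iter_open.
have op p (U : set X) : open U -> U `<=` dr_idom p ->
    open (U `&` iter p T @^-1` O).
  move=> oU DU; rewrite openE => z [Uz Oz]; apply: filterI.
    by apply: open_nbhs_nbhs; split.
  by apply: dr_iter_continuous (open_nbhs_nbhs _); [apply: DU|split].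
exists (V1 `&` iter m T @^-1` O), (W1 `&` iter n T @^-1` O); split.
- split=> //=.
  + by split; [apply: op|move=> z [/DV1]].
  + by split; [apply: op|move=> z [/DW1]].
  + by move=> s t /set_mem[Vs _] /set_mem[Vt _]; apply: iV1; rewrite inE.
  + by move=> s t /set_mem[Ws _] /set_mem[Wt _]; apply: iW1; rewrite inE.
  + rewrite eqEsubset; split=> z.
      by move=> [s [Vs Os] <-]; have [_ [t Wt et]] := Os;
        exists t; rewrite /= ?et.
    by move=> [t [Wt Ot] <-]; have [[s Vs es] _] := Ot;
      exists s; rewrite /= ?es.
- by split=> //; split=> /=; [exists x|exists y].
- by split=> //; split=> /=; [exists x|exists y].
- by move=> z [/sV1].
- by move=> z [/sW1].
Qed.

Lemma dr_base_cover : \bigcup_(i in dr_base_index) dr_base i = setT.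
Proof.
rewrite eqEsubset; split=> // g _; have [m [n r]] := dr_arrP g.
have [V [W [DVW Vx Wy _ _]]] := dr_base_local r filterT filterT.
by case: r => _ _ ? ?; exists ((m, V), (n, W)).
Qed.

Lemma dr_lag_shift (m n p q : nat) : (m <= p)%N ->
  (m%:Z - n%:Z = p%:Z - q%:Z)%R -> exists j, p = (m + j)%N /\ q = (n + j)%N.
Proof.
move=> mp e; exists (p - m)%N; rewrite subnKC //; split=> //.
apply/eqP; rewrite -eqz_nat PoszD -subzn //; apply/eqP.
have -> : (q%:Z = p%:Z - (p%:Z - q%:Z))%R by rewrite opprB addrC subrK.
by rewrite -e opprB addrCA addrC addrAC addrC.
Qed.

Lemma dr_base_join i j g : dr_base_index i -> dr_base_index j ->
  dr_base i g -> dr_base j g ->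
  exists k, [/\ dr_base_index k, dr_base k g &
    dr_base k `<=` dr_base i `&` dr_base j].
Proof.
move: i j => [[m V] [n W]] [[p V'] [q W']].
wlog mp : m n V W p q V' W' / (m <= p)%N => [H|].
  have [mp|/ltnW pm] := leqP m p; first exact: H.
  move=> Di Dj ig jg.
  have [k [? ? sk]] := H _ _ _ _ _ _ _ _ pm Dj Di jg ig.
  by exists k; split=> //; rewrite setIC.
move=> [[oV DV] [oW DW] _ _ _] [[oV' DV'] [oW' DW'] _ _ _].
move=> [Vx Wy lag_g e] [V'x W'y lag_g' e'].
have r : dr_rel m n (dr_rng g) (dr_lag g) (dr_src g).
  by split=> //; [apply: DV|apply: DW].
have nV : nbhs (dr_rng g) (V `&` V').
  by apply: open_nbhs_nbhs; split=> //; apply: openI.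
have nW : nbhs (dr_src g) (W `&` W').
  by apply: open_nbhs_nbhs; split=> //; apply: openI.
have [V2 [W2 [DVW V2x W2y sV sW]]] := dr_base_local r nV nW.
exists ((m, V2), (n, W2)); split=> //.
move=> h [/sV[Vh V'h] /sW[Wh W'h] lag_h eh]; split; split=> //.
  by rewrite lag_h -lag_g.
have [k [-> ->]] := dr_lag_shift mp (etrans (esym lag_g) lag_g').
by rewrite ![(_ + k)%N]addnC !iterD eh.
Qed.

HB.instance Definition _ :=
  isBaseTopological.Build dr_arr dr_base_cover dr_base_join.

Lemma dr_nbhsP g (A : set dr_arr) : nbhs g A <->
  exists m n (V W : set X), [/\ dr_rel m n (dr_rng g) (dr_lag g) (dr_src g),
    nbhs (dr_rng g) V, nbhs (dr_src g) W &
    forall h, V (dr_rng h) -> W (dr_src h) ->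
      dr_rel m n (dr_rng h) (dr_lag h) (dr_src h) -> A h].
Proof.
split.
  rewrite (@nbhsE dr_arr g) => -[B [[D' D'D <-] [[[m V] [n W]] D'i ig]] sBA].
  have [[oV DV] [oW DW] _ _ _] := D'D _ D'i.
  have [Vx Wy lag_g e] := ig.
  exists m, n, V, W; split.
  - by split=> //; [apply: DV|apply: DW].
  - by apply: open_nbhs_nbhs; split.
  - by apply: open_nbhs_nbhs; split.
  - move=> h Vh Wh [_ _ lag_h eh]; apply: sBA.
    by exists ((m, V), (n, W)).
move=> [m [n [V [W [r nV nW VWA]]]]].
have [V' [W' [Di V'x W'y sV sW]]] := dr_base_local r nV nW.
rewrite (@nbhsE dr_arr g); exists (dr_base ((m, V'), (n, W'))).
  split; last by case: r.
  exists [set ((m, V'), (n, W'))]; first by move=> _ ->.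
  by rewrite bigcup_set1.
move=> h [V'h W'h lag_h eh]; apply: VWA; [exact: sV|exact: sW|].
by have [[_ DV'] [_ DW'] _ _ _] := Di; split=> //; [apply: DV'|apply: DW'].
Qed.

Lemma dr_idn_subproof x : exists m n, dr_rel m n x 0%R x.
Proof. by exists 0%N, 0%N; split. Qed.

Lemma dr_inv_subproof g :
  exists m n, dr_rel m n (dr_src g) (- dr_lag g)%R (dr_rng g).
Proof.
by have [m [n [? ? -> ?]]] := dr_arrP g; exists n, m; split; rewrite ?opprB.
Qed.

Lemma dr_relD j m n x k y : dr_rel m n x k y -> dr_idom j (iter m T x) ->
  dr_rel (m + j) (n + j) x k y.
Proof.
move=> [Dx Dy -> e] Dj; split.
- exact/dr_idomD.
- by apply/dr_idomD; rewrite -e.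
- by rewrite !PoszD opprD addrACA subrr addr0.
- by rewrite ![(_ + j)%N]addnC !iterD e.
Qed.

Lemma dr_rel_common g h : dr_src g = dr_rng h -> exists a r c,
  dr_rel a r (dr_rng g) (dr_lag g) (dr_src g) /\
  dr_rel r c (dr_rng h) (dr_lag h) (dr_src h).
Proof.
move=> e; have [m [n rg]] := dr_arrP g; have [p [q rh]] := dr_arrP h.
have [np|/ltnW pn] := leqP n p.
  exists (m + (p - n))%N, p, q; split=> //.
  rewrite -{2}(subnKC np); apply: dr_relD => //.
  have [_ _ _ ->] := rg; have [+ _ _ _] := rh.
  by rewrite e -{1}(subnKC np) => /dr_idomD[].
exists m, n, (q + (n - p))%N; split=> //.
rewrite -{1}(subnKC pn); apply: dr_relD => //.
by have [_ + _ _] := rg; rewrite e -{1}(subnKC pn) => /dr_idomD[].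
Qed.

Lemma dr_rel_trans a r c x k y l z : dr_rel a r x k y -> dr_rel r c y l z ->
  dr_rel a c x (k + l)%R z.
Proof.
move=> [? _ -> exy] [_ ? -> eyz]; split; rewrite ?exy //.
by rewrite addrA subrK.
Qed.

Lemma dr_mul_subproof g h : dr_src g = dr_rng h ->
  exists m n, dr_rel m n (dr_rng g) (dr_lag g + dr_lag h)%R (dr_src h).
Proof.
move=> e; have [a [r [c [rg rh]]]] := dr_rel_common e.
by exists a, c; apply: dr_rel_trans rg _; rewrite e.
Qed.

Definition dr_idn (x : X) : dr_arr := DRArr (dr_idn_subproof x).
Definition dr_inv g : dr_arr := DRArr (dr_inv_subproof g).
Definition dr_mul g h (e : dr_src g = dr_rng h) : dr_arr :=
  DRArr (dr_mul_subproof e).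

Lemma dr_mul_idl x g (e : dr_src (dr_idn x) = dr_rng g) : dr_mul e = g.
Proof. by apply: dr_arr_eq => //=; rewrite add0r. Qed.

Lemma dr_mul_idr g x (e : dr_src g = dr_rng (dr_idn x)) : dr_mul e = g.
Proof. by apply: dr_arr_eq => //=; rewrite addr0. Qed.

Lemma dr_mul_invl g (e : dr_src (dr_inv g) = dr_rng g) :
  dr_mul e = dr_idn (dr_src g).
Proof. by apply: dr_arr_eq => //=; rewrite addNr. Qed.

Lemma dr_mul_invr g (e : dr_src g = dr_rng (dr_inv g)) :
  dr_mul e = dr_idn (dr_rng g).
Proof. by apply: dr_arr_eq => //=; rewrite subrr. Qed.

Lemma dr_mul_assoc g h k (gh : dr_src g = dr_rng h) (hk : dr_src h = dr_rng k)
  (gh_k : dr_src (dr_mul gh) = dr_rng k)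
  (g_hk : dr_src g = dr_rng (dr_mul hk)) : dr_mul gh_k = dr_mul g_hk.
Proof. by apply: dr_arr_eq => //=; rewrite addrA. Qed.

Lemma dr_src_continuous : continuous dr_src.
Proof.
move=> g U nU; apply/dr_nbhsP; have [m [n r]] := dr_arrP g.
by exists m, n, setT, U; split=> //; apply: filterT.
Qed.

Lemma dr_rng_continuous : continuous dr_rng.
Proof.
move=> g U nU; apply/dr_nbhsP; have [m [n r]] := dr_arrP g.
by exists m, n, U, setT; split=> //; apply: filterT.
Qed.

Lemma dr_idn_continuous : continuous dr_idn.
Proof.
move=> x U /dr_nbhsP[m [n [V [W [[Dm Dn /esym/eqP + _] nV nW VWU]]]]].
rewrite subr_eq0 eqz_nat => /eqP mn; subst n.
rewrite nbhs_simpl /=; near=> y; apply: VWU => /=; try by near: y.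
have Dy : dr_idom m y by near: y; apply: dr_idom_near.
by split=> //; rewrite subrr.
Unshelve. all: by end_near.
Qed.

Lemma dr_inv_continuous : continuous dr_inv.
Proof.
move=> g U /dr_nbhsP[m [n [V [W [[/= Dm Dn lag e] nV nW VWU]]]]].
apply/dr_nbhsP; exists n, m, W, V; split=> //.
  by split=> //; rewrite -[LHS]opprK lag opprB.
move=> h Wh Vh [? ? lag_h ?]; apply: VWU => //.
by split=> //=; rewrite lag_h opprB.
Qed.

Lemma dr_mul_continuous :
  continuous (fun p : [set p : dr_arr * dr_arr | dr_src p.1 = dr_rng p.2] =>
    dr_mul (set_valP p)).
Proof.
pose C := [set p : dr_arr * dr_arr | dr_src p.1 = dr_rng p.2].
have c1 : continuous (fun p : C => (val p).1).
  move=> p; apply: continuous_comp; first exact: initial_continuous.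
  exact: cvg_fst.
have c2 : continuous (fun p : C => (val p).2).
  move=> p; apply: continuous_comp; first exact: initial_continuous.
  exact: cvg_snd.
move=> p U /dr_nbhsP[M [N [V [W [/= r nV nW VWU]]]]].
have := set_valP p; rewrite /= => e.
have [a [b [c [rg rh]]]] := dr_rel_common e.
have rgh := dr_rel_trans rg (eq_rect_r (fun y => dr_rel b c y _ _) rh e).
have [V' [W' [nV' nW' VW]]] : exists V' W' : set X,
    [/\ nbhs (dr_rng (val p).1) V', nbhs (dr_src (val p).2) W' &
      forall x k z, V' x -> W' z -> dr_rel a c x k z -> dr_rel M N x k z].
  have [DM DN lagr er] := r; have [Da Dc lagr' er'] := rgh.
  have [Ma|/ltnW aM] := leqP M a.
    have [j [ea ec]] := dr_lag_shift Ma (etrans (esym lagr) lagr').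
    have Dj : dr_idom j (iter M T (dr_rng (val p).1)).
      by move: Da; rewrite ea => /dr_idomD[].
    have [O [nO iO]] := dr_iter_inj Dj.
    exists (dr_idom M `&` iter M T @^-1` O), (dr_idom N `&` iter N T @^-1` O).
    split.
    - by apply: filterI; [apply: dr_idom_near|apply: dr_iter_continuous].
    - apply: filterI; first exact: dr_idom_near.
      by apply: dr_iter_continuous => //; rewrite -er.
    - move=> x k z [DMx Ox] [DNz Oz] [_ _ -> exz]; split=> //.
        by rewrite -lagr' lagr.
      apply: iO; rewrite ?inE // -!iterD.
      by move: exz; rewrite ea ec ![(_ + j)%N]addnC.
  have [j [eM eN]] := dr_lag_shift aM (etrans (esym lagr') lagr).
  exists (dr_idom M), (dr_idom N); split; try exact: dr_idom_near.
  move=> x k z; rewrite eM eN => Dx Dz rx.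
  by apply: dr_relD => //; have /dr_idomD[] := Dx.
rewrite nbhs_simpl /=.
have near1 : nbhs (val p).1 [set g | (V `&` V') (dr_rng g) /\
    dr_rel a b (dr_rng g) (dr_lag g) (dr_src g)].
  apply/dr_nbhsP; exists a, b, (V `&` V'), setT; split=> //.
    exact: filterI.
  exact: filterT.
have near2 : nbhs (val p).2 [set h | (W `&` W') (dr_src h) /\
    dr_rel b c (dr_rng h) (dr_lag h) (dr_src h)].
  apply/dr_nbhsP; exists b, c, setT, (W `&` W'); split=> //.
    exact: filterT.
  exact: filterI.
have n1 : nbhs p [set q : C | (V `&` V') (dr_rng (val q).1) /\
    dr_rel a b (dr_rng (val q).1) (dr_lag (val q).1) (dr_src (val q).1)].
  exact: (c1 p _ near1).
have n2 : nbhs p [set q : C | (W `&` W') (dr_src (val q).2) /\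
    dr_rel b c (dr_rng (val q).2) (dr_lag (val q).2) (dr_src (val q).2)].
  exact: (c2 p _ near2).
apply: filterS2 n1 n2 => q [[Vq V'q] rgq] [[Wq W'q] rhq]; apply: VWU => //=.
apply: VW => //; apply: dr_rel_trans rgq _.
by have := set_valP q => /= ->.
Qed.

Definition dr_groupoid : topGroupoid := {|
  gobj := X;
  garr := dr_arr;
  gsrc := dr_src;
  grng := dr_rng;
  gidn := dr_idn;
  gmul := dr_mul;
  ginv := dr_inv;
  gsrc_idn := fun=> erefl;
  grng_idn := fun=> erefl;
  gsrc_mul := fun _ _ _ => erefl;
  grng_mul := fun _ _ _ => erefl;
  gsrc_inv := fun=> erefl;
  grng_inv := fun=> erefl;
  gmul_idl := dr_mul_idl;
  gmul_idr := dr_mul_idr;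
  gmul_invl := dr_mul_invl;
  gmul_invr := dr_mul_invr;
  gmul_assoc := dr_mul_assoc;
  gsrc_continuous := dr_src_continuous;
  grng_continuous := dr_rng_continuous;
  gidn_continuous := dr_idn_continuous;
  ginv_continuous := dr_inv_continuous;
  gmul_continuous := dr_mul_continuous
|}.

End DeaconuRenaultGroupoid.

(* Main.v *)
Require Import Defs.
From mathcomp Require Import all_boot all_order all_algebra.
From mathcomp Require Import all_classical topology.

(* Cut dom(T) into finitely many disjoint clopen pieces U_a on which T is
   injective; the inverse branches theta_a := (T|U_a)^-1 generate a
   semi-saturated orthogonal partial action of the free group.  Conversely, an
   orthogonal action glues its maps theta_a^-1 into a single local
   homeomorphism T on the union of the X_a.  In both cases orthogonality forces
   every g with X_g nonempty to be a quotient u v^-1 of positive words whose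
   lengths add up, and semi-saturation then says that theta_g x = y means that u
   and v are itineraries of y and x with T^|u| y = T^|v| x.  Hence
   (g, x) |-> (theta_g x, |u| - |v|, x) is an isomorphism of topological
   groupoids. *)

Set Implicit Arguments.
Unset Strict Implicit.
Unset Printing Implicit Defensive.

Import Order.TTheory GRing.Theory.

Local Open Scope classical_set_scope.

(** * Isomorphism of topological groupoids as an equivalence relation *)

(** [gmul] takes a proof of composability, which blocks plain rewriting of the factors; proof
    irrelevance removes this dependency. *)
Lemma gmul_congr (G : topGroupoid) (g g' h h' : garr G)
    (e : gsrc g = grng h) (e' : gsrc g' = grng h') :
  g = g' -> h = h' -> gmul e = gmul e'.
Proof. by move=> eg eh; subst; congr gmul; apply: Prop_irrelevance. Qed.

Lemma homeo_betweenC (X Y : topologicalType) (A : set X) (B : set Y) f g :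
  homeo_between A B f g -> homeo_between B A g f.
Proof. by case=> ? ? [? ?] ? ?; split. Qed.

Lemma homeo_setTP (X Y : topologicalType) (f : X -> Y) (g : Y -> X) :
  homeo_between setT setT f g <->
  [/\ cancel f g, cancel g f, continuous f & continuous g].
Proof.
split=> [[_ _ [fK gK] cf cg]|[fK gK cf cg]]; split=> //.
- by move=> x; apply: fK.
- by move=> y; apply: gK.
- exact: (iffRL (continuous_subspace_setT f)).
- exact: (iffRL (continuous_subspace_setT g)).
- exact: (iffLR (continuous_subspace_setT f)).
- exact: (iffLR (continuous_subspace_setT g)).
Qed.

Lemma groupoid_iso_sym (G H : topGroupoid) :
  groupoid_iso G H -> groupoid_iso H G.
Proof.
move=> [f0 [g0 [f1 [g1 [h0 h1 [fsrc frng] fidn fmul]]]]].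
have /homeo_setTP[f0K g0K _ _] := h0; have /homeo_setTP[f1K g1K _ _] := h1.
exists g0, f0, g1, f1; split; try exact: homeo_betweenC.
- by split=> g; rewrite -[LHS]f0K -?fsrc -?frng g1K.
- by move=> x; rewrite -[RHS]f1K fidn g0K.
- move=> g h e e'; rewrite -[RHS]f1K.
  have ef : gsrc (f1 (g1 g)) = grng (f1 (g1 h)) by rewrite !g1K.
  by rewrite (fmul _ _ e' ef); congr g1; apply: gmul_congr; rewrite g1K.
Qed.

Lemma groupoid_iso_trans (G H K : topGroupoid) :
  groupoid_iso G H -> groupoid_iso H K -> groupoid_iso G K.
Proof.
move=> [f0 [g0 [f1 [g1 [/homeo_setTP[f0K g0K cf0 cg0]
  /homeo_setTP[f1K g1K cf1 cg1] [fsrc frng] fidn fmul]]]]].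
move=> [f0' [g0' [f1' [g1' [/homeo_setTP[f0K' g0K' cf0' cg0']
  /homeo_setTP[f1K' g1K' cf1' cg1'] [fsrc' frng'] fidn' fmul']]]]].
exists (f0' \o f0), (g0 \o g0'), (f1' \o f1), (g1 \o g1'); split.
- apply/homeo_setTP; split; try exact: can_comp.
  + by move=> x; apply: continuous_comp; [apply: cf0|apply: cf0'].
  + by move=> x; apply: continuous_comp; [apply: cg0'|apply: cg0].
- apply/homeo_setTP; split; try exact: can_comp.
  + by move=> x; apply: continuous_comp; [apply: cf1|apply: cf1'].
  + by move=> x; apply: continuous_comp; [apply: cg1'|apply: cg1].
- by split=> g /=; rewrite ?fsrc' ?frng' ?fsrc ?frng.
- by move=> x /=; rewrite fidn fidn'.
- move=> g h e e' /=.
  have e1 : gsrc (f1 g) = grng (f1 h) by rewrite fsrc frng e.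
  by rewrite (fmul _ _ e e1) (fmul' _ _ e1 e').
Qed.

(** * Words in the free group *)

Section FreeGroupWords.
Variable A : choiceType.
Implicit Types (a b : A) (u v : seq A) (g h : free_group A).

Lemma reduced_word_inj : injective (@reduced_word A).
Proof. exact: val_inj. Qed.

Lemma size_cons_red (x : letter A) (w : seq (letter A)) :
  (size (cons_red x w) <= (size w).+1)%N.
Proof. by case: w => //= y w; case: ifP => //= _; rewrite leqW. Qed.

Lemma fg_length_mul g h : (fg_length (g * h)%g <= fg_length g + fg_length h)%N.
Proof.
rewrite /fg_length /=; elim: (reduced_word g) => //= x w IH.
by apply: leq_trans (size_cons_red _ _) _; rewrite addSn ltnS.
Qed.

Lemma fg_lengthV g : fg_length g^-1%g = fg_length g.
Proof. by rewrite /fg_length /= /inv_red size_rev size_map. Qed.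

Definition fg_sign (x : letter A) : int := (if x.2 then 1 else -1)%R.
(** The homomorphism from the free group to Z that sends each generator to 1; it becomes the lag of
    an arrow. *)
Definition fg_exp g : int := (\sum_(x <- reduced_word g) fg_sign x)%R.

Lemma fg_sign_inv x : fg_sign (letter_inv x) = (- fg_sign x)%R.
Proof. by case: x => a []; rewrite /fg_sign /= ?opprK. Qed.

Lemma fg_expM g h : fg_exp (g * h)%g = (fg_exp g + fg_exp h)%R.
Proof.
rewrite /fg_exp /=; elim: (reduced_word g) => [|x w IH] /=.
  by rewrite big_nil add0r.
rewrite big_cons -addrA -IH; case: (mul_red _ _) => [|y w'] /=.
  by rewrite big_cons.
by case: eqP => [->|_]; rewrite !big_cons // fg_sign_inv addrA subrr add0r.
Qed.

Lemma fg_exp1 : fg_exp 1%g = 0%R.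
Proof. by rewrite /fg_exp big_nil. Qed.

Lemma fg_expV g : fg_exp g^-1%g = (- fg_exp g)%R.
Proof. by apply/eqP; rewrite -addr_eq0 -fg_expM mulVg fg_exp1. Qed.

Lemma reduced_pos u : reduced [seq (a, true) | a <- u].
Proof.
rewrite /reduced; elim: u => //= a [|b u] //= ->; rewrite andbT.
by apply/eqP => -[].
Qed.

Definition fg_pos u : free_group A := FreeGroup (reduced_pos u).

Lemma fg_pos_nil : fg_pos [::] = 1%g.
Proof. exact: reduced_word_inj. Qed.

Lemma fg_pos_cons a u : fg_pos (a :: u) = (fg_gen a * fg_pos u)%g.
Proof.
by apply: reduced_word_inj; rewrite /= cons_red_cons //;
  apply: (reduced_pos (a :: u)).
Qed.

Lemma fg_pos_cat u v : fg_pos (u ++ v) = (fg_pos u * fg_pos v)%g.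
Proof.
elim: u => [|a u IH]; first by rewrite fg_pos_nil mul1g.
by rewrite cat_cons !fg_pos_cons IH mulgA.
Qed.

Lemma fg_length_pos u : fg_length (fg_pos u) = size u.
Proof. by rewrite /fg_length /= size_map. Qed.

Lemma fg_exp_pos u : fg_exp (fg_pos u) = Posz (size u).
Proof.
rewrite /fg_exp /= big_map; elim: u => [|a u IH]; first by rewrite big_nil.
by rewrite big_cons IH /= /fg_sign /= -[in RHS]add1n PoszD.
Qed.

(** Induction on the reduced word from the left. The length equation is kept because it is the
    premise of semi-saturation. *)
Lemma fg_ind (P : free_group A -> Prop) : P 1%g ->
  (forall a (b : bool) g, let x := if b then fg_gen a else (fg_gen a)^-1%g in
     fg_length (x * g)%g = (fg_length g).+1 -> P g -> P (x * g)%g) ->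
  forall g, P g.
Proof.
move=> P1 Pcons [w rw]; elim: w rw => [|[a b] w IH] rw.
  by rewrite (_ : FreeGroup rw = 1%g) //; apply: reduced_word_inj.
have rw' : reduced w by apply: reduced_behead rw.
have E : FreeGroup rw =
    ((if b then fg_gen a else (fg_gen a)^-1) * FreeGroup rw')%g.
  by apply: reduced_word_inj; case: b rw => rw;
    rewrite /= /inv_red /= cons_red_cons.
rewrite E; apply: Pcons => //.
by rewrite -E.
Qed.

End FreeGroupWords.

(** * Groupoids of orthogonal semi-saturated actions *)

Section DeaconuRenaultRelations.
Variables (X : topologicalType) (S : deaconuRenault X).
Local Notation T := (dr_map S).

(** Splits off the first application of T, whereas [dr_idomS] splits off the last; itineraries are
    read from the first letter. *)
Lemma dr_idom_cons n x : dr_idom S n.+1 x <-> dr_dom S x /\ dr_idom S n (T x).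
Proof.
rewrite -add1n; split=> [/dr_idomD[/(_ 0%N) + ?]|[Dx Dn]]; first by split; auto.
by apply/dr_idomD; split=> // -[].
Qed.

(* Two pairs of exponents witnessing the same arrow differ by a common shift;
   when the shift is downwards, local injectivity of the iterates of T recovers
   the smaller pair nearby. *)
Lemma dr_rel_nbhs M N a c x k y : dr_rel S M N x k y -> dr_rel S a c x k y ->
  exists V W : set X, [/\ nbhs x V, nbhs y W &
    forall x' y', V x' -> W y' -> dr_rel S a c x' k y' ->
      dr_rel S M N x' k y'].
Proof.
move=> [DM DN kMN e] [Da Dc kac _].
have [Ma|/ltnW aM] := leqP M a.
  have [j [ea ec]] := dr_lag_shift Ma (etrans (esym kMN) kac).
  have Dj : dr_idom S j (iter M T x) by move: Da; rewrite ea => /dr_idomD[].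
  have [O [nO iO]] := dr_iter_inj Dj.
  exists (dr_idom S M `&` iter M T @^-1` O), (dr_idom S N `&` iter N T @^-1` O).
  split.
  - by apply: filterI; [apply: dr_idom_near|apply: dr_iter_continuous].
  - apply: filterI; first exact: dr_idom_near.
    by apply: dr_iter_continuous => //; rewrite -e.
  - move=> x' y' [DMx Ox] [DNy Oy] [_ _ _ exy]; split=> //.
    apply: iO; rewrite ?inE // -!iterD.
    by move: exy; rewrite ea ec ![(_ + j)%N]addnC.
have [j [eM eN]] := dr_lag_shift aM (etrans (esym kac) kMN).
exists (dr_idom S M), (dr_idom S N); split; try exact: dr_idom_near.
move=> x' y'; rewrite eM eN => Dx Dy r.
by apply: dr_relD => //; have /dr_idomD[] := Dx.
Qed.

End DeaconuRenaultRelations.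

(** * The isomorphism when T restricts to theta_a^-1 on each X_a *)

Section OrthogonalIso.
Variables (A : choiceType) (X : topologicalType).
Variables (theta : partialAction (free_group A) X) (S : deaconuRenault X).
Local Notation D := (pa_dom theta).
Local Notation act := (pa_act theta).
Local Notation T := (dr_map S).
Hypothesis semisat : pa_semi_saturated theta.
Hypothesis orth : pa_orthogonal theta.
Hypothesis domE : dr_dom S = \bigcup_a D (fg_gen a).
Hypothesis mapE : forall a x, D (fg_gen a) x -> T x = act (fg_gen a)^-1%g x.
Implicit Types (a b : A) (u v : seq A) (g h : free_group A) (x y z : X).

Lemma pa_act_dom g x : D g^-1%g x -> D g (act g x).
Proof. by have [f _ _ _ _] := pa_homeo theta g; apply: f. Qed.

Lemma pa_actK g x : D g^-1%g x -> act g^-1%g (act g x) = x.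
Proof. by have [_ _ [f _] _ _] := pa_homeo theta g; apply: f. Qed.

Lemma pa_actVK g x : D g x -> act g (act g^-1%g x) = x.
Proof. by have [_ _ [_ f] _ _] := pa_homeo theta g; apply: f. Qed.

Lemma pa_actV_dom g x : D g x -> D g^-1%g (act g^-1%g x).
Proof. by move=> Dx; apply: pa_act_dom; rewrite invgK. Qed.

Lemma pa_gen_inj a b x : D (fg_gen a) x -> D (fg_gen b) x -> a = b.
Proof.
move=> Da Db; apply/eqP/negP => /negP /orth ab.
by have : set0 x by rewrite -ab.
Qed.

(** Semi-saturation for (a u)^-1 = u^-1 a^-1, a product without cancellation whose first step is T.
    Hence X_u consists of the points with itinerary u. *)
Lemma pa_posE a u x : D (fg_pos (a :: u)) x <->
  D (fg_gen a) x /\ D (fg_pos u) (T x).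
Proof.
have [|+ _] := @semisat (fg_pos u)^-1%g (fg_gen a)^-1%g.
  by rewrite -invgM -fg_pos_cons !fg_lengthV !fg_length_pos addn1.
rewrite -invgM -fg_pos_cons !invgK => ->.
by split=> -[Da Du]; split; rewrite ?(mapE Da) // -(mapE Da).
Qed.

Lemma pa_pos_actV a u x : D (fg_pos (a :: u)) x ->
  act (fg_pos (a :: u))^-1%g x = act (fg_pos u)^-1%g (T x).
Proof.
move=> Dx; have [Da _] := (iffLR (pa_posE _ _ _)) Dx.
have [|_] := @semisat (fg_pos u)^-1%g (fg_gen a)^-1%g.
  by rewrite -invgM -fg_pos_cons !fg_lengthV !fg_length_pos addn1.
rewrite -invgM -fg_pos_cons !invgK => /(_ x Dx) ->.
by rewrite -mapE.
Qed.

Lemma pa_pos_iter u x : D (fg_pos u) x ->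
  dr_idom S (size u) x /\ act (fg_pos u)^-1%g x = iter (size u) T x.
Proof.
elim: u x => [|a u IH] x Dx.
  by rewrite fg_pos_nil invg1 pa_act1.
have [Da Du] := (iffLR (pa_posE _ _ _)) Dx.
have [Dn e] := IH _ Du.
split; last by rewrite pa_pos_actV // e -iterSr.
by apply/dr_idom_cons; split=> //; rewrite domE; exists a.
Qed.

Lemma pa_pos_itinerary n x : dr_idom S n x ->
  exists2 u, size u = n & D (fg_pos u) x.
Proof.
elim: n x => [|n IH] x; first by exists [::]; rewrite ?fg_pos_nil ?pa_dom1.
move=> /dr_idom_cons[]; rewrite domE => -[a _ Da] /IH[u su Du].
by exists (a :: u); rewrite /= ?su //; apply/pa_posE.
Qed.

(** By orthogonality, a point determines each letter of its itinerary in turn. *)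
Lemma pa_pos_uniq u v x : size u = size v ->
  D (fg_pos u) x -> D (fg_pos v) x -> u = v.
Proof.
elim: u v x => [|a u IH] [|b v] x //= [suv].
move=> /pa_posE[Da Du] /pa_posE[Db Dv].
by rewrite (pa_gen_inj Da Db) (IH _ _ suv Du Dv).
Qed.

Lemma pa_pos_cat u v x : D (fg_pos (u ++ v)) x <->
  D (fg_pos u) x /\ D (fg_pos v) (iter (size u) T x).
Proof.
elim: u x => [|a u IH] x; first by rewrite fg_pos_nil pa_dom1; split=> [|[]].
rewrite cat_cons [size _]/= iterSr.
split=> [/pa_posE[Da /IH[Du Dv]]|[/pa_posE[Da Du] Dv]].
  by split=> //; apply/pa_posE.
by apply/pa_posE; split=> //; apply/IH.
Qed.

(** theta_v^-1 sends x to T^|v| x = T^|u| y, and theta_u sends this point to y; the composition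
    axiom covers u v^-1 even when letters cancel. *)
Lemma pa_pos_div u v x y : D (fg_pos u) y -> D (fg_pos v) x ->
  iter (size u) T y = iter (size v) T x ->
  let g := (fg_pos u * (fg_pos v)^-1)%g in D g^-1%g x /\ act g x = y.
Proof.
move=> Du Dv e /=; have [_ eu] := pa_pos_iter Du; have [_ ev] := pa_pos_iter Dv.
have [||Dx ->] := @pa_actM _ _ theta (fg_pos u) (fg_pos v)^-1%g x.
- by rewrite invgK.
- by rewrite ev -e -eu; apply: pa_actV_dom.
- by split=> //; rewrite ev -e -eu pa_actVK.
Qed.

(** Converse of [pa_pos_div]: when the lengths add up, semi-saturation splits theta_(u v^-1) into
    theta_u after theta_v^-1. *)
Lemma pa_dom_pos_div u v x :
  fg_length (fg_pos u * (fg_pos v)^-1)%g = (size u + size v)%N ->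
  let g := (fg_pos u * (fg_pos v)^-1)%g in D g^-1%g x ->
  [/\ D (fg_pos u) (act g x), D (fg_pos v) x &
      iter (size u) T (act g x) = iter (size v) T x].
Proof.
move=> luv g Dx.
have [|domg actg] := @semisat (fg_pos u) (fg_pos v)^-1%g.
  by rewrite luv fg_lengthV !fg_length_pos.
have := Dx; rewrite /g domg invgK actg // => -[Dv Du].
have Dact := pa_act_dom Du; split=> //.
have [_ <-] := pa_pos_iter Dact; have [_ <-] := pa_pos_iter Dv.
by rewrite pa_actK.
Qed.

(* Orthogonality forbids a^-1 followed by b with a <> b, so all positive
   letters of a word acting somewhere precede the negative ones. *)
Lemma pa_dom_normal_form g x : D g^-1%g x -> exists u v,
  g = (fg_pos u * (fg_pos v)^-1)%g /\ fg_length g = (size u + size v)%N.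
Proof.
elim/fg_ind: g => [|a b g] /=.
  by exists [::], [::]; rewrite fg_pos_nil mulgV.
set c := if b then _ else _ => lg IH Dx.
have [|domg actg] := @semisat c g.
  by rewrite lg /c; case: ifP; rewrite ?fg_lengthV.
move: (Dx); rewrite domg => -[Dg Dc].
have [u [v [eg lgE]]] := IH Dg.
rewrite lg lgE; move: lg Dc => {Dx domg actg}; rewrite {}/c; case: b => [|].
  by move=> _ _; exists (a :: u), v; rewrite fg_pos_cons eg mulgA.
rewrite invgK; case: u => [|b u] in eg lgE *.
  (* With u empty, the new letter joins the negative part: a^-1 v^-1 = (v a)^-1. *)
  move=> _ _; exists [::], (rcons v a); split; last by rewrite size_rcons.
  by rewrite eg fg_pos_nil !mul1g -cats1 fg_pos_cat invgM fg_pos_cons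
    fg_pos_nil mulg1.
move=> lg Da.
have [||+ _ _] := @pa_dom_pos_div (b :: u) v x.
- by rewrite -eg.
- by rewrite -eg.
rewrite -eg => /pa_posE[Db _].
(* Both X_a and X_b contain theta_g x, so a = b; then a^-1 cancels the first letter, against the
   growth of length in [lg]. *)
move: lg; rewrite (pa_gen_inj Da Db) lgE eg fg_pos_cons.
rewrite !mulgA mulVg mul1g => lg.
have := fg_length_mul (fg_pos u) (fg_pos v)^-1%g.
rewrite lg fg_lengthV !fg_length_pos /= => /ltnW.
by rewrite addSn ltnn.
Qed.

(** The point x only shows that the domain is nonempty: one pair u, v serves all its points.
    Continuity in both directions rests on this uniformity. *)
Lemma pa_dom_pos_divP g x : D g^-1%g x -> exists u v,
  g = (fg_pos u * (fg_pos v)^-1)%g /\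
  forall y, D g^-1%g y -> [/\ D (fg_pos u) (act g y), D (fg_pos v) y &
      iter (size u) T (act g y) = iter (size v) T y].
Proof.
move=> /pa_dom_normal_form[u [v [-> luv]]]; exists u, v; split=> // y.
exact: pa_dom_pos_div.
Qed.

Lemma fg_exp_pos_div u v :
  fg_exp (fg_pos u * (fg_pos v)^-1)%g = (Posz (size u) - Posz (size v))%R.
Proof. by rewrite fg_expM fg_expV !fg_exp_pos. Qed.

Lemma pa_dr_rel g x : D g^-1%g x -> exists m n, forall y, D g^-1%g y ->
  dr_rel S m n (act g y) (fg_exp g) y.
Proof.
move=> /pa_dom_pos_divP[u [v [eg uvP]]]; exists (size u), (size v) => y Dy.
have [Du Dv e] := uvP _ Dy.
have [idu _] := pa_pos_iter Du; have [idv _] := pa_pos_iter Dv.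
by split=> //; rewrite {1}eg fg_exp_pos_div.
Qed.

(** By uniqueness of itineraries u' = u w and v' = v w', where w and w' have equal length and are
    both itineraries of T^|u| y = T^|v| x. So w = w', which cancels in u' v'^-1. *)
Lemma pa_pos_div_inj u v u' v' x y :
  D (fg_pos u) y -> D (fg_pos v) x -> iter (size u) T y = iter (size v) T x ->
  D (fg_pos u') y -> D (fg_pos v') x ->
  (Posz (size u) - Posz (size v) = Posz (size u') - Posz (size v'))%R ->
  (size u <= size u')%N ->
  (fg_pos u * (fg_pos v)^-1 = fg_pos u' * (fg_pos v')^-1)%g.
Proof.
move=> Du Dv e Du' Dv' lag uu'; have [j [su sv]] := dr_lag_shift uu' lag.
have eu : size (take (size u) u') = size u by rewrite size_takel.
have ev : size (take (size v) v') = size v by rewrite size_takel // sv leq_addr.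
move: Du' Dv'; rewrite -(cat_take_drop (size u) u') => /pa_pos_cat[Du' Dt].
rewrite -(cat_take_drop (size v) v') => /pa_pos_cat[Dv' Dw].
rewrite eu e in Dt; rewrite ev in Dw.
have edrop : size (drop (size u) u') = size (drop (size v) v').
  by rewrite !size_drop su sv !addKn.
rewrite (pa_pos_uniq eu Du' Du) (pa_pos_uniq ev Dv' Dv).
rewrite (pa_pos_uniq edrop Dt Dw).
by rewrite !fg_pos_cat invgM mulgA mulgK.
Qed.

Lemma pa_dr_inj g h x : D g^-1%g x -> D h^-1%g x -> act g x = act h x ->
  fg_exp g = fg_exp h -> g = h.
Proof.
move=> /[dup] Dg /pa_dom_pos_divP[u [v [eg uvP]]].
move=> /[dup] Dh /pa_dom_pos_divP[u' [v' [eh uvP']]] egh.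
have [Du Dv e] := uvP _ Dg; have [Du' Dv' e'] := uvP' _ Dh.
rewrite -egh in Du' e'.
rewrite {1}eg {1}eh !fg_exp_pos_div eg eh => lag.
have [uu'|/ltnW u'u] := leqP (size u) (size u').
  exact: (pa_pos_div_inj Du Dv e Du' Dv' lag uu').
exact/esym/(pa_pos_div_inj Du' Dv' e' Du Dv (esym lag) u'u).
Qed.

Lemma pa_to_dr_subproof (p : pa_arr theta) :
  exists m n, dr_rel S m n (pa_rng p) (fg_exp (pa_elt p)) (pa_src p).
Proof.
have [m [n r]] := pa_dr_rel (pa_arrP p).
by exists m, n; apply: r; apply: pa_arrP.
Qed.

Definition pa_to_dr (p : pa_arr theta) : dr_arr S :=
  DRArr (pa_to_dr_subproof p).

Lemma pa_to_dr_inj : injective pa_to_dr.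
Proof.
move=> p q [er el es]; apply: pa_arr_eq => //.
apply: (@pa_dr_inj _ _ (pa_src p)); first exact: pa_arrP.
- by rewrite es; apply: pa_arrP.
- by rewrite {2}es.
- exact: el.
Qed.

Lemma pa_to_dr_surj (h : dr_arr S) : exists p, pa_to_dr p = h.
Proof.
have [m [n [Dm Dn lag e]]] := dr_arrP h.
have [u su Du] := pa_pos_itinerary Dm; have [v sv Dv] := pa_pos_itinerary Dn.
have [|Dx exy] := pa_pos_div Du Dv; first by rewrite su sv.
exists (pa_mk Dx); apply: dr_arr_eq => //.
by rewrite lag -su -sv -fg_exp_pos_div.
Qed.

(** The exponents of an arrow are known only to exist, so a preimage is chosen; injectivity makes
    the choice unique. *)
Definition dr_to_pa (h : dr_arr S) : pa_arr theta :=
  projT1 (cid (pa_to_dr_surj h)).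

Lemma dr_to_paK : cancel dr_to_pa pa_to_dr.
Proof. by move=> h; rewrite /dr_to_pa; case: cid. Qed.

Lemma pa_to_drK : cancel pa_to_dr dr_to_pa.
Proof. by move=> p; apply: pa_to_dr_inj; rewrite dr_to_paK. Qed.

(** The group element is locally constant and has one pair of exponents on its whole domain;
    [dr_rel_nbhs] passes from that pair to the one of the given neighbourhood. *)
Lemma pa_to_dr_continuous : continuous pa_to_dr.
Proof.
move=> p U /dr_nbhsP[M [N [V [W [/= r nV nW VWU]]]]].
have [a [c rac]] := pa_dr_rel (pa_arrP p).
have [V' [W' [nV' nW' VW']]] := dr_rel_nbhs r (rac _ (pa_arrP p)).
have nVV : nbhs (pa_rng p) (V `&` V') by exact: filterI.
have nWW : nbhs (pa_src p) (W `&` W') by exact: filterI.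
have n1 := @pa_rng_continuous _ _ theta p _ nVV.
have n2 := @pa_src_continuous _ _ theta p _ nWW.
rewrite nbhs_simpl /=; apply: filterS3 (pa_elt_near p) n1 n2.
move=> q eq [Vq V'q] [Wq W'q]; apply: VWU => //=; rewrite eq.
apply: VW' => //; rewrite /pa_rng eq; apply: rac.
by rewrite -eq; apply: pa_arrP.
Qed.

(** If h comes from u v^-1, every arrow from X_v to X_u with exponents |u|, |v| comes from the same
    group element, and such arrows form a neighbourhood of h. *)
Lemma dr_to_pa_continuous : continuous dr_to_pa.
Proof.
apply: pa_continuous => [h|].
  have := pa_arrP (dr_to_pa h); set g := pa_elt _ => Dg.
  have [u [v [eg uvP]]] := pa_dom_pos_divP Dg.
  have [Du Dv e] := uvP _ Dg.
  have eh : pa_to_dr (dr_to_pa h) = h := dr_to_paK h.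
  rewrite /nbhs /=; apply/dr_nbhsP.
  exists (size u), (size v), (D (fg_pos u)), (D (fg_pos v)).
  have clop w : open (D (fg_pos w)) by have [] := pa_clopen theta (fg_pos w).
  split.
  - rewrite -eh; split=> //=; first by have [] := pa_pos_iter Du.
      by have [] := pa_pos_iter Dv.
    by rewrite -/g {1}eg fg_exp_pos_div.
  - by apply: open_nbhs_nbhs; split=> //; rewrite -eh.
  - by apply: open_nbhs_nbhs; split=> //; rewrite -eh.
  - move=> k Duk Dvk [_ _ lag ek].
    have [Dx exy] := pa_pos_div Duk Dvk ek.
    have -> : k = pa_to_dr (pa_mk Dx).
      by apply: dr_arr_eq => //=; rewrite lag -fg_exp_pos_div.
    by rewrite pa_to_drK; apply/esym.
have -> : @pa_src _ _ theta \o dr_to_pa = @dr_src _ S.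
  by apply/funext => h; rewrite -{2}[h]dr_to_paK.
exact: dr_src_continuous.
Qed.

Lemma pa_dr_iso : groupoid_iso (pa_groupoid theta) (dr_groupoid S).
Proof.
exists id, id, pa_to_dr, dr_to_pa; split.
- by apply/homeo_setTP; split=> // x; apply: cvg_id.
- apply/homeo_setTP; split.
  + exact: pa_to_drK.
  + exact: dr_to_paK.
  + exact: pa_to_dr_continuous.
  + exact: dr_to_pa_continuous.
- by split.
- by move=> x; apply: dr_arr_eq => //=; [apply: pa_act1|apply: fg_exp1].
- move=> p q e e'; apply: dr_arr_eq => //; first exact: pa_rng_mul.
  exact: fg_expM.
Qed.

End OrthogonalIso.

(** * Partial actions generated by letters *)

(** Any cancellation shortens the product, so additive lengths exclude it. *)
Lemma mul_red_cat (A : choiceType) (u v : seq (letter A)) :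
  size (mul_red u v) = (size u + size v)%N -> mul_red u v = u ++ v.
Proof.
elim: u => //= x u IH e.
have euv : mul_red u v = u ++ v.
  apply: IH; apply/eqP; rewrite eqn_leq; apply/andP; split.
    elim: u {e} => //= y u IHu; apply: leq_trans (size_cons_red _ _) _.
    by rewrite addSn ltnS.
  by rewrite -ltnS -addSn -e size_cons_red.
move: e; rewrite euv; case: (u ++ v) (size_cat u v) => //= y w sw.
by case: ifP => // _; rewrite addSn -sw => e; have := ltnn (size w);
  rewrite {2}e leqW.
Qed.

Section LettersAction.
Variables (A : choiceType) (X : topologicalType).
(** [R l x y] is read as theta_l x = y; a relation carries its domain, so composites get their
    natural domains. [Ropen] expresses continuity together with openness of the domain. *)
Variable R : letter A -> X -> X -> Prop.
Hypothesis lcX : locally_compact [set: X].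
Hypothesis hausX : hausdorff_space X.
Hypothesis tdX : totally_disconnected [set: X].
Hypothesis RV : forall l x y, R l x y -> R (letter_inv l) y x.
Hypothesis Rfun : forall l x y z, R l x y -> R l x z -> y = z.
Hypothesis Ropen : forall l (U : set X), open U ->
  open [set x | exists2 y, R l x y & U y].
Hypothesis Rclosed : forall l, closed [set x | exists y, R l x y].
Implicit Types (l : letter A) (u v w : seq (letter A)) (g h : free_group A).

Fixpoint word_rel w x y : Prop :=
  if w is l :: w' then exists2 z, word_rel w' x z & R l z y else x = y.

Lemma word_rel_cat u v x y :
  word_rel (u ++ v) x y <-> exists2 z, word_rel v x z & word_rel u z y.
Proof.
elim: u y => [|l u IH] y /=; first by split=> [|[z + <-]] //; exists y.
split=> [[t /IH[z xz zt] ty]|[z xz [t zt ty]]].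
  by exists z => //; exists t.
by exists t => //; apply/IH; exists z.
Qed.

Lemma word_rel_fun w x y z : word_rel w x y -> word_rel w x z -> y = z.
Proof.
elim: w y z => [|l w IH] y z /=; first by move=> <-.
by move=> [t xt ty] [t' /(IH _ _ xt) <- tz]; apply: Rfun ty tz.
Qed.

Lemma word_rel_inv w x y : word_rel (inv_red w) x y <-> word_rel w y x.
Proof.
suff H w' s t : word_rel w' s t -> word_rel (inv_red w') t s.
  by split=> /H //; rewrite inv_redK.
elim: w' t => [|l w' IH] t /=; first by [].
move=> [z /IH sz zt]; rewrite /inv_red /= rev_cons -cats1; apply/word_rel_cat.
by exists z => //=; exists t => //; apply: RV.
Qed.

(** An adjacent pair of inverse letters acts as a restriction of the identity, so deleting it only
    enlarges the partial map. This yields the composition axiom. *)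
Lemma word_rel_mul u v x y z :
  word_rel v x y -> word_rel u y z -> word_rel (mul_red u v) x z.
Proof.
move=> xy; elim: u z => [|l u IH] z /=; first by move=> <-.
move=> [t /IH {IH}]; case: (mul_red u v) => [|l' w] /=.
  by move=> <-; exists x.
case: eqP => [->|_] /=; last by move=> xt tz; exists t.
move=> [s xs st] tz; have /Rfun := RV st; rewrite letter_invK => /(_ _ tz).
by move=> <-.
Qed.

Lemma word_rel_open w (U : set X) : open U ->
  open [set x | exists2 y, word_rel w x y & U y].
Proof.
elim: w U => [|l w IH] U oU.
  rewrite (_ : [set x | _] = U) // eqEsubset; split=> x; last by exists x.
  by move=> [y /= ->].
rewrite (_ : [set x | _] = [set x | exists2 z, word_rel w x z &
  [set z | exists2 y, R l z y & U y] z]); first exact/IH/Ropen.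
rewrite eqEsubset; split=> x /=.
  by move=> [y [z xz zy] Uy]; exists z => //; exists y.
by move=> [z xz [y zy Uy]]; exists y => //; exists z.
Qed.

Lemma word_rel_clopen w (U : set X) : clopen U ->
  clopen [set x | exists2 y, word_rel w x y & U y].
Proof.
move=> clU; split; first by apply: word_rel_open; case: clU.
elim: w U clU => [|l w IH] U [oU cU].
  rewrite (_ : [set x | _] = U) // eqEsubset; split=> x; last by exists x.
  by move=> [y /= ->].
rewrite (_ : [set x | _] = [set x | exists2 z, word_rel w x z &
  [set z | exists2 y, R l z y & U y] z]); last first.
  rewrite eqEsubset; split=> x /=.
    by move=> [y [z xz zy] Uy]; exists z => //; exists y.
  by move=> [z xz [y zy Uy]]; exists y => //; exists z.
apply: IH; split; first exact: Ropen.
(* As R l is single-valued, the preimage of U is the closed domain minus the open preimage of the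
   complement of U. *)
rewrite (_ : [set z | _] = [set z | exists y, R l z y] `&`
  ~` [set z | exists2 y, R l z y & (~` U) y]).
  by apply: closedI; [apply: Rclosed|apply/open_closedC/Ropen/closed_openC].
rewrite eqEsubset; split=> x /=.
  move=> [y xy Uy]; split; first by exists y.
  by move=> [y' xy']; rewrite (Rfun xy' xy).
move=> [[y xy] nU]; exists y => //; apply: contrapT => nUy.
by apply: nU; exists y.
Qed.

Definition letters_dom g : set X := [set y | exists x, word_rel g x y].
(** Outside the domain the value defaults to x itself. *)
Definition letters_act g x : X := xget x [set y | word_rel g x y].

Lemma letters_domV g x : letters_dom g^-1%g x <-> exists y, word_rel g x y.
Proof.
by split=> -[y] => [/word_rel_inv|?]; exists y => //; apply/word_rel_inv.
Qed.

Lemma letters_actE g x y : word_rel g x y -> letters_act g x = y.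
Proof.
move=> xy; rewrite /letters_act; case: xgetP => [z _ /= xz|/(_ y)//].
exact: word_rel_fun xz xy.
Qed.

Lemma letters_clopen g : clopen (letters_dom g).
Proof.
rewrite (_ : letters_dom g =
  [set y | exists2 x, word_rel (inv_red g) y x & setT x]).
  exact/word_rel_clopen/clopenT.
rewrite eqEsubset; split=> y /= [x].
  by exists x => //; apply/word_rel_inv.
by move=> /word_rel_inv; exists x.
Qed.

Lemma letters_act_fun g :
  set_fun (letters_dom g^-1%g) (letters_dom g) (letters_act g).
Proof. by move=> x /letters_domV[y xy]; rewrite (letters_actE xy); exists x. Qed.

Lemma letters_actK g x :
  letters_dom g^-1%g x -> letters_act g^-1%g (letters_act g x) = x.
Proof.
move=> /letters_domV[y xy]; rewrite (letters_actE xy); apply: letters_actE.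
exact/word_rel_inv.
Qed.

Lemma letters_act_continuous g :
  {within letters_dom g^-1%g, continuous (letters_act g)}.
Proof.
have [oD _] := letters_clopen g^-1%g.
rewrite continuous_open_subspace //; apply/continuous_inP => // U oU.
rewrite (_ : _ `&` _ = [set x | exists2 y, word_rel g x y & U y]).
  exact: word_rel_open.
rewrite eqEsubset; split=> x /=.
  by move=> [/letters_domV[y xy]]; rewrite (letters_actE xy); exists y.
move=> [y xy Uy]; rewrite (letters_actE xy); split=> //.
by apply/letters_domV; exists y.
Qed.

Lemma letters_homeo g : homeo_between (letters_dom g^-1%g) (letters_dom g)
  (letters_act g) (letters_act g^-1%g).
Proof.
split; [exact: letters_act_fun| | |exact: letters_act_continuous|].
- by have := @letters_act_fun g^-1%g; rewrite invgK.
- split; first exact: letters_actK.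
  by move=> y Dy; have := @letters_actK g^-1%g y; rewrite invgK; apply.
- by have := @letters_act_continuous g^-1%g; rewrite invgK.
Qed.

Lemma letters_dom1 : letters_dom 1%g = setT.
Proof. by rewrite eqEsubset; split=> // x _; exists x. Qed.

Lemma letters_act1 x : letters_act 1%g x = x.
Proof. exact: letters_actE. Qed.

Lemma letters_actM g h x :
  letters_dom h^-1%g x -> letters_dom g^-1%g (letters_act h x) ->
  letters_dom (g * h)^-1%g x /\
  letters_act (g * h)%g x = letters_act g (letters_act h x).
Proof.
move=> /letters_domV[y xy]; rewrite (letters_actE xy) => /letters_domV[z yz].
have xz : word_rel (g * h)%g x z := word_rel_mul xy yz.
rewrite (letters_actE yz) (letters_actE xz); split=> //.
by apply/letters_domV; exists z.
Qed.

Definition letters_action : partialAction (free_group A) X :=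
  PartialAction lcX hausX tdX letters_clopen letters_homeo
    letters_dom1 letters_act1 letters_actM.

(** When lengths add up, the product is the concatenation of the words, which acts by the exact
    composite. *)
Lemma letters_semi_saturated : pa_semi_saturated letters_action.
Proof.
move=> g h lgh /=.
have relM x y : word_rel (g * h)%g x y <->
    exists2 z, word_rel h x z & word_rel g z y.
  by rewrite -word_rel_cat -mul_red_cat.
split.
  rewrite eqEsubset; split=> x /=.
    move=> /letters_domV[y /relM[z xz zy]]; rewrite (letters_actE xz).
    by split; apply/letters_domV; [exists z|exists y].
  move=> [/letters_domV[z xz]]; rewrite (letters_actE xz).
    move=> /letters_domV[y zy].
  by apply/letters_domV; exists y; apply/relM; exists z.
move=> x /letters_domV[y xy]; have /relM[z xz zy] := xy.
by rewrite (letters_actE xy) (letters_actE xz) (letters_actE zy).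
Qed.

Lemma letters_dom_gen a y :
  letters_dom (fg_gen a) y <-> exists x, R (a, true) x y.
Proof.
split; first by move=> [x [_ /= <-]]; exists x.
by move=> [x xy]; exists x; exists x.
Qed.

Lemma letters_act_genV a x y :
  R (a, true) y x -> letters_act (fg_gen a)^-1%g x = y.
Proof. by move=> yx; apply: letters_actE; apply/word_rel_inv; exists y. Qed.

End LettersAction.

(** * Totally disconnected compact spaces *)

Lemma compact_finite_subcover (X : topologicalType) (P : set (set X))
    (K : set X) :
  compact K -> (forall x, K x -> exists2 V, P V & nbhs x V) ->
  exists2 s : seq (set X), {in s, forall V, P V} &
    forall x, K x -> exists2 V, V \in s & V x.
Proof.
move=> /compact_near_coveringP cK KP.
pose B := [set s : seq (set X) | {in s, forall V, P V}].
(* Lists are ordered by inclusion: a property holds eventually when all lists containing some finite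
   list from P have it. The near-covering form of compactness then gives one list for all of K. *)
pose F := filter_from B (fun s => [set t : seq (set X) | {subset s <= t}]).
have FF : Filter F.
  apply: filter_from_filter; first by exists [::].
  move=> s t Bs Bt; exists (s ++ t).
    by move=> V; rewrite mem_cat => /orP[/Bs|/Bt].
  by move=> r str; split=> V Vs; apply: str; rewrite mem_cat Vs ?orbT.
have [|s Bs sK] := cK _ F (fun s x => exists2 V, V \in s & V x) FF.
  move=> x /KP[V PV nV]; exists (V, [set t | {subset [:: V] <= t}]) => /=.
    split=> //; exists [:: V] => //.
    by move=> W; rewrite inE => /eqP ->.
  by move=> [y t] /= [Vy st]; exists V => //; apply: st; rewrite inE.
by exists s => // x Kx; apply: (sK s).
Qed.

Section TotallyDisconnectedCompact.
Variable X : topologicalType.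
Hypothesis cptX : compact [set: X].
Hypothesis hausX : hausdorff_space X.

Lemma compact_separated (B C : set X) : closed B -> closed C ->
  B `&` C = set0 -> exists U V : set X,
  [/\ open U, open V, B `<=` U, C `<=` V & U `&` V = set0].
Proof.
move=> cB cC BC.
have [|W BW WC] := compact_normal hausX cptX cB (_ : set_nbhs B (~` C)).
  apply/set_nbhsP; exists (~` C); split=> //; first exact: closed_openC.
  by move=> x Bx Cx; have : (B `&` C) x by []; rewrite BC.
have [U [oU BU UW]] := (iffLR (set_nbhsP _ _)) BW.
exists U, (~` closure W); split=> //.
- by apply: closed_openC; apply: closed_closure.
- by move=> x Cx /WC.
- rewrite eqEsubset; split=> // x [/UW Wx]; apply.
  exact: subset_closure.
Qed.

Definition quasi_component (x : X) : set X :=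
  [set y | forall U, clopen U -> U x -> U y].

Lemma quasi_component_closed x : closed (quasi_component x).
Proof.
rewrite (_ : quasi_component x = \bigcap_(U in [set U | clopen U /\ U x]) U).
  by apply: closed_bigI => U [[]].
rewrite eqEsubset; split=> y Qy; first by move=> U [clU Ux]; apply: Qy.
by move=> U clU Ux; apply: Qy.
Qed.

(** The compact complement of O is covered by finitely many clopen sets missing x; the intersection
    of their complements is the required set. *)
Lemma quasi_component_nbhs x (O : set X) : open O -> quasi_component x `<=` O ->
  exists2 U, clopen U /\ U x & U `<=` O.
Proof.
move=> oO QO.
have cptO : compact (~` O).
  by apply: subclosed_compact cptX _ => //; apply: open_closedC.
pose P := [set V | clopen V /\ ~ V x].
have [|s sP sO] := @compact_finite_subcover _ P _ cptO.
  move=> y nOy; have [U clU [Ux nUy]] : exists2 U, clopen U & U x /\ ~ U y.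
    apply: contrapT => nU; apply: nOy; apply: QO => U clU Ux.
    by apply: contrapT => nUy; apply: nU; exists U.
  exists (~` U); first by split; [exact: clopenC|apply].
  by have [_ cU] := clU; apply: open_nbhs_nbhs; split=> //; apply: closed_openC.
have [U [clU Ux] sU] : exists2 U, clopen U /\ U x &
    forall V, V \in s -> U `&` V = set0.
  elim: s sP {sO} => [|V s IH] sP.
    by exists setT => //; split=> //; apply: clopenT.
  have [|U [clU Ux] sU] := IH.
    by move=> W Ws; apply: sP; rewrite inE Ws orbT.
  have [clV nVx] := sP V (mem_head _ _).
  exists (U `&` ~` V).
    by split=> //; apply: clopenI => //; exact: clopenC.
  move=> W; rewrite inE => /predU1P[->|/sU UW].
    by rewrite -setIA setICl setI0.
  by rewrite setIAC UW set0I.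
exists U => // y Uy; apply: contrapT => /sO[V Vs Vy].
by have : (U `&` V) y by []; rewrite sU.
Qed.

(** A splitting of Q extends to disjoint open sets U, V. A clopen K around x inside their union is
    cut by them into clopen halves, and the half containing x contains all of Q. *)
Lemma quasi_component_connected x : connected (quasi_component x).
Proof.
set Q := quasi_component x.
move=> B [b Bb] [C oC BC] [D cD BD].
have cB : closed B.
  by rewrite BD; apply: closedI => //; apply: quasi_component_closed.
have cQB : closed (Q `&` ~` C).
  by apply: closedI; [apply: quasi_component_closed|apply: open_closedC].
have [|U [V [oU oV BU QV UV]]] := compact_separated cB cQB.
  by rewrite eqEsubset; split=> // y []; rewrite {1}BC => -[_ Cy] [].
have QUV : Q `<=` U `|` V.
  move=> y Qy; have [Cy|nCy] := pselect (C y); last by right; apply: QV.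
  by left; apply: BU; rewrite BC.
have [K [clK Kx] KUV] := quasi_component_nbhs (openU oU oV) QUV.
have cl (O O' : set X) : open O -> open O' -> O `&` O' = set0 ->
    K `<=` O `|` O' -> clopen (K `&` O).
  move=> oO oO' OO' KO; split; first by apply: openI => //; case: clK.
  rewrite (_ : K `&` O = K `&` ~` O').
    by apply: closedI; [case: clK|apply: open_closedC].
  rewrite eqEsubset; split=> y [Ky Oy]; split=> //.
    by move=> O'y; have : (O `&` O') y by []; rewrite OO'.
  by case: (KO _ Ky).
have Qb : Q b by move: Bb; rewrite BC => -[].
rewrite BC; apply/setIidPl => y Qy; apply: contrapT => nCy.
have Vy : V y by apply: QV.
have [Ux|nUx] := pselect (U x).
  have [_ Uy] := Qy _ (cl _ _ oU oV UV KUV) (conj Kx Ux).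
  by have : (U `&` V) y by []; rewrite UV.
have Vx : V x by case: (KUV _ Kx).
rewrite setIC in UV; rewrite setUC in KUV.
have [_ Vb] := Qb _ (cl _ _ oV oU UV KUV) (conj Kx Vx).
have : (V `&` U) b by split=> //; apply: BU.
by rewrite UV.
Qed.

Lemma totally_disconnected_zero_dimensional :
  totally_disconnected [set: X] -> zero_dimensional X.
Proof.
move=> tdX x y xy; apply: contrapT => nU.
have Qy : quasi_component x y.
  by move=> U clU Ux; apply: contrapT => nUy; apply: nU; exists U.
have : connected_component [set: X] x y.
  exists (quasi_component x) => //; split=> //.
  exact: quasi_component_connected.
by rewrite tdX // => /= /esym/eqP; apply/negP.
Qed.

Lemma clopen_nbhs_base x (U : set X) : totally_disconnected [set: X] ->
  nbhs x U -> exists2 V, clopen V /\ V x & V `<=` U.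
Proof.
move=> /totally_disconnected_zero_dimensional zX nU.
have [V [Vx clV] VU] := zero_dimensional_cvg hausX zX cptX nU.
by exists V.
Qed.

End TotallyDisconnectedCompact.

(** * Clopen partitions of dom(T) into pieces on which T is injective *)

Lemma clopen_partition (X : topologicalType) (s : seq (set X)) :
  {in s, forall V, clopen V} ->
  exists U : 'I_(size s) -> set X,
  [/\ forall i, clopen (U i), forall i, exists2 V, V \in s & U i `<=` V,
    forall i j, i != j -> U i `&` U j = set0 &
    \bigcup_i U i = \bigcup_(V in [set` s]) V].
Proof.
move=> cls; pose V i := nth set0 s i.
(* Past the end of the list the default [set0] is clopen too, so no bound on i is required. *)
have clV i : clopen (V i).
  have [si|si] := ltnP i (size s); first by apply: cls; apply: mem_nth.
  by rewrite /V nth_default //; apply: clopen0.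
(* Removing the earlier sets makes the pieces disjoint; a point lies in the piece of the least index
   whose set contains it. *)
pose U i := V i `&` \bigcap_(j in [set j | (j < i)%N]) ~` V j.
exists (fun i => U i); split.
- move=> i; apply: clopenI => //; elim: (nat_of_ord i) => [|n IH].
    rewrite (_ : \bigcap_(j in _) _ = setT); first exact: clopenT.
    by rewrite eqEsubset; split=> // x _ j.
  rewrite (_ : \bigcap_(j in _) _ =
      ~` V n `&` \bigcap_(j in [set j | (j < n)%N]) ~` V j).
    by apply: clopenI => //; apply: (clopenC set0 (clV n)).
  rewrite eqEsubset; split=> x /=.
    move=> H; split; first by apply: H => /=.
    by move=> j /= jn; apply: H => /=; rewrite ltnS ltnW.
  by move=> [nV H] j /=; rewrite ltnS leq_eqVlt => /orP[/eqP ->|/H].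
- by move=> i; exists (V i); [apply: mem_nth|move=> x []].
- move=> i j ij; wlog lij : i j ij / (i < j)%N.
    move=> H; have := ij; rewrite -val_eqE neq_ltn => /orP[/H|ji]; first exact.
    by rewrite setIC; apply: H => //; rewrite eq_sym.
  by rewrite eqEsubset; split=> // x [[Vx _] [_ /(_ i lij)]].
- rewrite eqEsubset; split=> x.
    by move=> [i _ [Vx _]]; exists (V i) => //=; apply: mem_nth.
  move=> [W /= Ws Wx]; have ex : exists i, `[< V i x >].
    by exists (index W s); apply/asboolP; rewrite /V nth_index.
  have [i /asboolP Vx imin] := ex_minnP ex.
  have si : (i < size s)%N.
    by rewrite ltnNge; apply/negP => si; move: Vx; rewrite /V nth_default.
  exists (Ordinal si) => //; split=> // j /= ji Vjx.
  by have := imin j; rewrite leqNgt ji; move=> /(_ (asboolT Vjx)).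
Qed.

(** dom(T) is closed, hence compact, so finitely many clopen sets of injectivity cover it; these are
    then made disjoint. *)
Lemma local_homeo_partition (X : topologicalType) (S : deaconuRenault X) :
  compact [set: X] -> totally_disconnected [set: X] -> clopen (dr_dom S) ->
  exists (n : nat) (U : 'I_n -> set X),
  [/\ forall i, clopen (U i), forall i, set_inj (U i) (dr_map S),
    forall i j, i != j -> U i `&` U j = set0 & dr_dom S = \bigcup_i U i].
Proof.
move=> cptX tdX [_ cdom]; have hausX := dr_hausdorff S.
have cptdom : compact (dr_dom S) by apply: subclosed_compact cptX _.
pose P := [set V : set X |
  [/\ clopen V, V `<=` dr_dom S & set_inj V (dr_map S)]].
have [|s sP sdom] := @compact_finite_subcover _ P _ cptdom.
  move=> x Dx; have [O [nO iO]] := dr_map_inj Dx.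
  have nD : nbhs x (dr_dom S).
    by apply: open_nbhs_nbhs; split=> //; apply: dr_dom_open.
  have [V [clV Vx] VO] := clopen_nbhs_base cptX hausX tdX (filterI nO nD).
  exists V; last by have [oV _] := clV; apply: open_nbhs_nbhs; split.
  split=> //; first by move=> y /VO[].
  by move=> y z /set_mem/VO[Oy _] /set_mem/VO[Oz _]; apply: iO; rewrite inE.
have [|U [clU sU dU cU]] := @clopen_partition _ s; first by move=> V /sP[].
exists (size s), U; split=> // [i|].
  have [V /sP[_ _ iV] UV] := sU i.
  by move=> y z /set_mem/UV Vy /set_mem/UV Vz; apply: iV; rewrite inE.
rewrite cU eqEsubset; split=> x; first by move=> /sdom[V Vs Vx]; exists V.
by move=> [V /= /sP[_ VD _]] /VD.
Qed.

(** * From local homeomorphisms to partial actions and back *)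

Section PartialActionOfPartition.
Variables (X : topologicalType) (S : deaconuRenault X).
Hypothesis cptX : compact [set: X].
Hypothesis tdX : totally_disconnected [set: X].
Local Notation T := (dr_map S).
Variables (A : choiceType) (U : A -> set X).
Hypothesis clU : forall a, clopen (U a).
Hypothesis injU : forall a, set_inj (U a) T.
Hypothesis disjU : forall a b, a != b -> U a `&` U b = set0.
Hypothesis domU : dr_dom S = \bigcup_a U a.

(** Positive letters act against T, by the inverse branches, so that X_a = U_a. *)
Definition branch_rel (l : letter A) (x y : X) : Prop :=
  if l.2 then U l.1 y /\ T y = x else U l.1 x /\ T x = y.

Let sub_dom a : U a `<=` dr_dom S.
Proof. by rewrite domU => x Ux; exists a. Qed.

Lemma branch_relV l x y : branch_rel l x y -> branch_rel (letter_inv l) y x.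
Proof. by case: l => a []. Qed.

Lemma branch_rel_fun l x y z : branch_rel l x y -> branch_rel l x z -> y = z.
Proof.
case: l => a [] [Uy Ty] [Uz Tz]; last by rewrite -Ty.
by apply: (@injU a); rewrite ?inE // Ty.
Qed.

Lemma branch_rel_open l (O : set X) : open O ->
  open [set x | exists2 y, branch_rel l x y & O y].
Proof.
case: l => a b oO; have [oU _] := clU a; case: b.
  rewrite (_ : [set x | _] = T @` (U a `&` O)).
    by apply: dr_map_open; [apply: openI|move=> x [/sub_dom]].
  rewrite eqEsubset; split=> x /=; first by move=> [y [Uy <-] Oy]; exists y.
  by move=> [y [Uy Oy] <-]; exists y.
rewrite (_ : [set x | _] = U a `&` T @^-1` O).
  move: O oO; apply/(continuous_inP _ oU) => x /set_mem Ux.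
  exact/dr_map_continuous/(sub_dom Ux).
rewrite eqEsubset; split=> x /=; first by move=> [y [Ux <-] Oy].
by move=> [Ux Ox]; exists (T x).
Qed.

Lemma branch_rel_closed l : closed [set x | exists y, branch_rel l x y].
Proof.
case: l => a b; have [oU cU] := clU a; case: b.
  (* The domain of the inverse branch is T(U_a), a compact image and therefore closed. *)
  rewrite (_ : [set x | _] = T @` U a).
    apply: compact_closed; first exact: dr_hausdorff S.
    apply: continuous_compact; last exact: subclosed_compact cptX _.
    rewrite continuous_open_subspace // => x /set_mem Ux.
    exact/dr_map_continuous/(sub_dom Ux).
  by rewrite eqEsubset; split=> x /=;
    [move=> [y [Uy <-]]|move=> [y Uy <-]]; exists y.
rewrite (_ : [set x | _] = U a) // eqEsubset; split=> x; first by move=> [y []].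
by move=> Ux; exists (T x).
Qed.

Lemma partition_action : exists theta : partialAction (free_group A) X,
  [/\ pa_semi_saturated theta, pa_orthogonal theta &
      groupoid_iso (pa_groupoid theta) (dr_groupoid S)].
Proof.
pose theta := letters_action (dr_locally_compact S) (dr_hausdorff S) tdX
  branch_relV branch_rel_fun branch_rel_open branch_rel_closed.
have domE a : pa_dom theta (fg_gen a) = U a.
  rewrite eqEsubset; split=> y.
    by move=> /letters_dom_gen[x []].
  by move=> Uy; apply/letters_dom_gen; exists (T y).
have semisat : pa_semi_saturated theta by exact: letters_semi_saturated.
have orth : pa_orthogonal theta by move=> a b ab; rewrite !domE disjU.
exists theta; split=> //; apply: pa_dr_iso => //.
  by rewrite domU; apply: eq_bigcupr => a _; rewrite domE.
move=> a x; rewrite domE => Ux; apply/esym/letters_act_genV => //.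
- exact: branch_relV.
- exact: branch_rel_fun.
Qed.

End PartialActionOfPartition.

(** * The local homeomorphism glued from an orthogonal action *)

Section DeaconuRenaultOfAction.
Variables (A : finType) (X : topologicalType).
Variable theta : partialAction (free_group A) X.
Hypothesis orth : pa_orthogonal theta.
Local Notation D := (pa_dom theta).
Local Notation act := (pa_act theta).

Definition pa_shift_dom : set X := \bigcup_a D (fg_gen a).

(** Orthogonality leaves at most one letter to pick; outside the union of the X_a the value defaults
    to x. *)
Definition pa_shift (x : X) : X :=
  if [pick a : A | `[< D (fg_gen a) x >]] is Some a
  then act (fg_gen a)^-1%g x else x.

Lemma pa_shiftE a x : D (fg_gen a) x -> pa_shift x = act (fg_gen a)^-1%g x.
Proof.
rewrite /pa_shift => Da; case: pickP => [b /asboolP Db|/(_ a)/asboolP//].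
by rewrite (pa_gen_inj orth Da Db).
Qed.

(** Finiteness of A makes the union of the closed sets X_a closed. *)
Lemma pa_shift_dom_clopen : clopen pa_shift_dom.
Proof.
split; first by apply: bigcup_open => a _; case: (pa_clopen theta (fg_gen a)).
apply: closed_bigcup => [|a _]; first exact: finite_finset.
by case: (pa_clopen theta (fg_gen a)).
Qed.

Lemma pa_shift_local_homeo : local_homeo_on pa_shift_dom pa_shift.
Proof.
move=> x [a _ Dx]; exists (D (fg_gen a)), (act (fg_gen a)).
have [h1 h2 [h3 h4] h5 h6] := pa_homeo theta (fg_gen a).
have imE : pa_shift @` D (fg_gen a) = D (fg_gen a)^-1%g.
  rewrite eqEsubset; split=> y.
    by move=> [z Dz <-]; rewrite (pa_shiftE Dz); apply: h2.
  move=> Dy; exists (act (fg_gen a) y); first exact: h1.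
  by rewrite (pa_shiftE (h1 _ Dy)) h3.
have [oD _] := pa_clopen theta (fg_gen a).
split=> //.
- by move=> y Dy; exists a.
- by rewrite imE; case: (pa_clopen theta (fg_gen a)^-1%g).
- rewrite imE; split=> //.
  + by move=> y Dy; rewrite (pa_shiftE Dy); apply: h2.
  + split=> y Dy; first by rewrite (pa_shiftE Dy) h4.
    by rewrite (pa_shiftE (h1 _ Dy)) h3.
  + apply: subspace_eq_continuous h6 => y /set_mem Dy.
    exact/esym/pa_shiftE.
Qed.

Definition pa_shift_system : deaconuRenault X :=
  DeaconuRenault (pa_locally_compact theta) (pa_hausdorff theta)
    (proj1 pa_shift_dom_clopen) pa_shift_local_homeo.

End DeaconuRenaultOfAction.

(** * The equivalence of the two descriptions of a groupoid *)

Theorem theorem2p2 (G : topGroupoid) :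
  (exists (X : topologicalType) (S : deaconuRenault X),
     [/\ compact [set: X], hausdorff_space X, totally_disconnected [set: X],
         clopen (dr_dom S) & groupoid_iso G (dr_groupoid S)])
  <->
  (exists (A : finType) (Y : topologicalType)
          (theta : partialAction (free_group A) Y),
     [/\ compact [set: Y], hausdorff_space Y, totally_disconnected [set: Y],
         pa_semi_saturated theta /\ pa_orthogonal theta &
         groupoid_iso G (pa_groupoid theta)]).
Proof.
split.
  move=> [X [S [cptX hausX tdX cldom isoG]]].
  have [n [U [clU injU disjU domU]]] := local_homeo_partition cptX tdX cldom.
  have [theta [semisat orth iso]] :=
    partition_action cptX tdX clU injU disjU domU.
  (* The indices of the clopen pieces serve as free generators; the space is unchanged. *)
  exists 'I_n, X, theta; split=> //.
  exact/(groupoid_iso_trans isoG)/groupoid_iso_sym.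
move=> [A [Y [theta [cptY hausY tdY [semisat orth] isoG]]]].
exists Y, (pa_shift_system orth); split=> //; first exact: pa_shift_dom_clopen.
apply: groupoid_iso_trans isoG _; apply: pa_dr_iso => // a x.
exact: pa_shiftE.
Qed.
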